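(* Let $A$ be a unital simple $C^*$-algebra. Then $\operatorname{hr} A = \operatorname{cpr} A$.
   Context: ''c.p.'' means completely positive, ''c.p.c.'' means completely positive contractive. A c.p. approximation $(F,\psi,\varphi)$ for a $C^*$-algebra $A$ consists of a finite-dimensional $C^*$-algebra $F$ and c.p.c. maps $\psi:A\to F$, $\varphi:F\to A$. Strict order: let $F$ be a finite-dimensional $C^*$-algebra. A set $\{e_0,\dots,e_n\}\subset F$ is elementary if the $e_i$ are mutually orthogonal minimal projections of $F$ ($n+1$ distinct elements). A c.p. map $\varphi:F\to A$ has strict order not exceeding $n$, $\operatorname{ord}\varphi\le n$ ($n\in\{0,1,2,\dots\}$), if for every elementary set $\{e_0,\dots,e_{n+1}\}\subset F$ there are distinct $i,j\in\{0,\dots,n+1\}$ with $\varphi(e_i)\varphi(e_j)=0$. $\operatorname{ord}\varphi$ is the least such $n$. Completely positive rank: $\operatorname{cpr}A\le n$ if there is a net $(F_\lambda,\psi_\lambda,\varphi_\lambda)_\Lambda$ of c.p. approximations for $A$ such that $\varphi_\lambda\circ\psi_\lambda\to\mathrm{id}_A$ pointwise in norm and $\operatorname{ord}\varphi_\lambda\le n$ for all $\lambda$. $\operatorname{cpr}A$ is the least such $n$ ($\infty$ if there is none). Piecewise homogeneous maps: let $F=\bigoplus_{i=1}^s M_{r_i}$, let $\varphi:F\to A$ be c.p.c., $\varphi_i:=\varphi|_{M_{r_i}}$, and let $\iota:\mathbb{C}^s\to F$ be the canonical unital embedding (onto the center of $F$). $\varphi$ is piecewise homogeneous (p.h.) if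 $\operatorname{ord}\varphi_i=0$ for all $i$; it is p.h. of strict order $n$ if it is p.h. and $\operatorname{ord}(\varphi\circ\iota)=n$. Homogeneous rank: $\operatorname{hr}A\le n$ if there is a net $(F_\lambda,\psi_\lambda,\varphi_\lambda)_\Lambda$ of c.p. approximations for $A$ such that $\varphi_\lambda\circ\psi_\lambda\to\mathrm{id}_A$ pointwise in norm and each $\varphi_\lambda$ is p.h. of strict order not exceeding $n$. $\operatorname{hr}A$ is the least such $n$ ($\infty$ if there is none). *)

(* Defs.v *)
(* The complex numbers are R[i], for R : realType. *)
From HB Require Import structures.
From mathcomp Require Import all_boot all_order all_algebra complex.
From mathcomp Require Import all_classical all_reals all_analysis.

Set Implicit Arguments.
Unset Strict Implicit.
Unset Printing Implicit Defensive.

Import Order.TTheory GRing.Theory Num.Theory numFieldNormedType.Exports.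
Local Open Scope classical_set_scope.
Local Open Scope ring_scope.
Local Open Scope complex_scope.

HB.mixin Record PzRing_isStarRing A of GRing.PzRing A := {
  star : A -> A;
  starK : involutive star;
  starD : {morph star : x y / x + y};
  starM : forall x y, star (x * y) = star y * star x }.

#[short(type="starRingType")]
HB.structure Definition StarRing := {A of GRing.PzRing A & PzRing_isStarRing A}.

(* Unital C*-algebras, the zero algebra included. The norm takes its values in
   the nonnegative reals inside R[i]. The hierarchy has no join of rings and
   normed modules other than the number domains, so the two structures are
   put together on the carrier [cstar_sort] below. *)
Record cstarAlgebra (R : realType) := CStarAlgebra {
  cstar_space : completeNormedModType R[i];
  cstar_mul : cstar_space -> cstar_space -> cstar_space;
  cstar_one : cstar_space;
  cstar_star : cstar_space -> cstar_space;
  cstar_mulA : associative cstar_mul;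
  cstar_mul1x : left_id cstar_one cstar_mul;
  cstar_mulx1 : right_id cstar_one cstar_mul;
  cstar_mulDl : left_distributive cstar_mul +%R;
  cstar_mulDr : right_distributive cstar_mul +%R;
  cstar_scaleAl : forall (c : R[i]) x y,
    c *: cstar_mul x y = cstar_mul (c *: x) y;
  cstar_scaleAr : forall (c : R[i]) x y,
    c *: cstar_mul x y = cstar_mul x (c *: y);
  cstar_starK : involutive cstar_star;
  cstar_starD : {morph cstar_star : x y / x + y};
  cstar_starZ : forall (c : R[i]) x, cstar_star (c *: x) = c^* *: cstar_star x;
  cstar_starM : forall x y,
    cstar_star (cstar_mul x y) = cstar_mul (cstar_star y) (cstar_star x);
  cstar_normM : forall x y, `|cstar_mul x y| <= `|x| * `|y|;
  cstar_norm_star : forall x, `|cstar_mul (cstar_star x) x| = `|x| ^+ 2 }.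

Definition cstar_sort (R : realType) (A : cstarAlgebra R) : Type :=
  cstar_space A.

Coercion cstar_sort : cstarAlgebra >-> Sortclass.

HB.instance Definition _ (R : realType) (A : cstarAlgebra R) :=
  CompleteNormedModule.copy (cstar_sort A) (cstar_space A).

HB.instance Definition _ (R : realType) (A : cstarAlgebra R) :=
  GRing.Zmodule_isPzRing.Build (cstar_sort A) (@cstar_mulA R A)
    (@cstar_mul1x R A) (@cstar_mulx1 R A) (@cstar_mulDl R A) (@cstar_mulDr R A).

HB.instance Definition _ (R : realType) (A : cstarAlgebra R) :=
  PzRing_isStarRing.Build (cstar_sort A) (@cstar_starK R A) (@cstar_starD R A)
    (@cstar_starM R A).

Definition finite_dimensional (R : realType) (F : cstarAlgebra R) : Prop :=
  exists (n : nat) (b : 'I_n -> F),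
    forall x, exists c : 'I_n -> R[i], x = \sum_(i < n) c i *: b i.

Definition simple (R : realType) (A : cstarAlgebra R) : Prop :=
  (1 : A) <> 0 /\
  forall J : set A, closed J ->
    J 0 -> (forall x y, J x -> J y -> J (x + y)) ->
    (forall (c : R[i]) x, J x -> J (c *: x)) ->
    (forall a x, J x -> J (a * x) /\ J (x * a)) ->
  J = [set 0] \/ J = [set: A].

Section MatrixStar.
Variables (R : realType) (n : nat).

Definition mxstar (x : 'M[R[i]]_n) : 'M[R[i]]_n := (map_mx conjc x)^T.

Lemma mxstarK : involutive mxstar.
Proof. by move=> x; apply/matrixP => i j; rewrite !mxE conjcK. Qed.

Lemma mxstarD : {morph mxstar : x y / x + y}.
Proof. by move=> x y; apply/matrixP => i j; rewrite !mxE rmorphD. Qed.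

Lemma mxstarM (x y : 'M[R[i]]_n) : mxstar (x * y) = mxstar y * mxstar x.
Proof. by rewrite /mxstar map_mxM trmx_mul. Qed.

HB.instance Definition _ :=
  PzRing_isStarRing.Build 'M[R[i]]_n mxstarK mxstarD mxstarM.

End MatrixStar.

(* The commutative algebra C^s, with pointwise operations. *)
Section FunStar.
Variables (R : realType) (s : nat).

Definition ffstar (x : {ffun 'I_s -> R[i]}) : {ffun 'I_s -> R[i]} :=
  [ffun i => (x i)^*].

Lemma ffstarK : involutive ffstar.
Proof. by move=> x; apply/ffunP => i; rewrite !ffunE conjcK. Qed.

Lemma ffstarD : {morph ffstar : x y / x + y}.
Proof. by move=> x y; apply/ffunP => i; rewrite !ffunE rmorphD. Qed.

Lemma ffstarM (x y : {ffun 'I_s -> R[i]}) :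
  ffstar (x * y) = ffstar y * ffstar x.
Proof. by apply/ffunP => i; rewrite !ffunE rmorphM mulrC. Qed.

HB.instance Definition _ :=
  PzRing_isStarRing.Build {ffun 'I_s -> R[i]} ffstarK ffstarD ffstarM.

End FunStar.

Section CompletelyPositive.
Variables (R : realType) (A B : cstarAlgebra R).

(* Positivity in the C*-algebra M_n(A): being of the form y^* y. *)
Definition mx_positive (D : cstarAlgebra R) n (x : 'M[D]_n) : Prop :=
  exists y : 'M[D]_n, x = (map_mx (star : D -> D) y)^T *m y.

Definition completely_positive (phi : A -> B) : Prop :=
  forall n (x : 'M[A]_n), mx_positive x -> mx_positive (map_mx phi x).

Definition cpc (phi : {linear A -> B}) : Prop :=
  completely_positive phi /\ forall x, `|phi x| <= `|x|.

End CompletelyPositive.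

Definition projection (A : starRingType) (p : A) : Prop :=
  star p = p /\ p * p = p.

(* For projections, q <= p means p q = q. *)
Definition minimal_projection (A : starRingType) (p : A) : Prop :=
  [/\ projection p, p <> 0 &
      forall q : A, projection q -> p * q = q -> q = 0 \/ q = p].

Definition elementary (F : starRingType) n (e : 'I_n -> F) : Prop :=
  [/\ injective e, forall i, minimal_projection (e i) &
      forall i j, i != j -> e i * e j = 0].

Definition ord_le (F A : starRingType) (phi : F -> A) (n : nat) : Prop :=
  forall e : 'I_n.+2 -> F, elementary e ->
    exists i j, i != j /\ phi (e i) * phi (e j) = 0.

(* Theta is a *-isomorphism from the direct sum of the M_{r_i}, with pointwise
   operations, onto F. *)
Definition direct_sum_iso (R : realType) (F : cstarAlgebra R) (s : nat)
    (r : 'I_s -> nat) (Theta : (forall i, 'M[R[i]]_(r i)) -> F) : Prop :=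
  [/\ bijective Theta,
      forall (c : R[i]) x y,
        Theta (fun i => c *: x i + y i) = c *: Theta x + Theta y,
      forall x y, Theta (fun i => x i * y i) = Theta x * Theta y &
      forall x, Theta (fun i => star (x i)) = star (Theta x)].

Definition summand (R : realType) (s : nat) (r : 'I_s -> nat) (i : 'I_s)
    (x : 'M[R[i]]_(r i)) : forall j, 'M[R[i]]_(r j) :=
  @dfwith _ (fun j => 'M[R[i]]_(r j)) (fun j => 0) i x.

Definition center_embedding (R : realType) (s : nat) (r : 'I_s -> nat)
    (c : {ffun 'I_s -> R[i]}) : forall j, 'M[R[i]]_(r j) :=
  fun j => (c j)%:M.

Definition ph_ord_le (R : realType) (F A : cstarAlgebra R) (phi : F -> A)
    (n : nat) : Prop :=
  exists (s : nat) (r : 'I_s -> nat)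
      (Theta : (forall i, 'M[R[i]]_(r i)) -> F),
    [/\ forall i, (0 < r i)%N, direct_sum_iso Theta,
        forall i, ord_le (phi \o Theta \o summand (i := i)) 0 &
        ord_le (phi \o Theta \o center_embedding r) n].

Definition directed (L : Type) (le : L -> L -> Prop) : Prop :=
  [/\ inhabited L, forall l, le l l,
      forall l m k, le l m -> le m k -> le l k &
      forall l m, exists k, le l k /\ le m k].

Definition tails (L : Type) (le : L -> L -> Prop) : set_system L :=
  filter_from [set: L] (fun l => [set m | le l m]).

Definition has_approximating_net (R : realType) (A : cstarAlgebra R)
    (P : forall F : cstarAlgebra R, (F -> A) -> Prop) : Prop :=
  exists (L : Type) (le : L -> L -> Prop) (F : L -> cstarAlgebra R)
      (psi : forall l, {linear A -> F l}) (phi : forall l, {linear F l -> A}),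
    [/\ directed le, forall l, finite_dimensional (F l),
        forall l, cpc (psi l) /\ cpc (phi l),
        forall a : A, phi l (psi l a) @[l --> tails le] --> a &
        forall l, P (F l) (phi l)].

Definition cpr_le (R : realType) (A : cstarAlgebra R) (n : nat) : Prop :=
  has_approximating_net (fun F (phi : F -> A) => ord_le phi n).

Definition hr_le (R : realType) (A : cstarAlgebra R) (n : nat) : Prop :=
  has_approximating_net (fun F (phi : F -> A) => ph_ord_le phi n).

(* The least n in N, or +oo for the empty set. *)
Definition least (R : realType) (N : set nat) : \bar R :=
  ereal_inf [set n%:R%:E | n in N].

Definition cpr (R : realType) (A : cstarAlgebra R) : \bar R :=
  least R (cpr_le A).

Definition hr (R : realType) (A : cstarAlgebra R) : \bar R :=
  least R (hr_le A).

(* Main.v *)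
(* A c.p.c. map phi of strict order at most n automatically has order zero on
   the matrix blocks of size at least n + 2: orthogonal frames are parametrized
   polynomially by Gram-Schmidt, so if phi(e_i) phi(e_j) = 0 for some pair i, j
   depending on the frame, then a fixed pair works for all frames. By the same
   argument ord (phi o iota) <= n. Only the small blocks are an obstruction.

   Let p_l be the unit of the small blocks in F_l and h_l = phi_l(p_l). As phi_l
   is asymptotically multiplicative along psi_l, the net h_l is asymptotically
   central, and h_l S(a) -> 0 for a standard polynomial S, which vanishes on
   small matrices. The z with h_l z -> 0 form a closed ideal, so by simplicity
   either h_l -> 0 and the small blocks can be dropped, or S vanishes on A.

   In the second case A has boundedly many orthogonal self-adjoint elements,
   since such elements x_0, x_1, ... give S(x_0 a_0 x_1, x_1 a_1 x_2, ...) <> 0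
   for suitable a_i. This forces A to be a sum of matrix algebras (which also
   provides the block structure of the F_l), and then A approximates itself. *)
Require Import Defs.
From HB Require Import structures.
From mathcomp Require Import all_boot all_order all_algebra complex.
From mathcomp Require Import all_classical all_reals all_analysis.
From mathcomp Require Import fingroup perm ring lra zify.
From Stdlib.setoid_ring Require Ncring Ncring_tac.

Set Implicit Arguments.
Unset Strict Implicit.
Unset Printing Implicit Defensive.

Import Order.TTheory GRing.Theory Num.Theory numFieldNormedType.Exports.
Local Open Scope classical_set_scope.
Local Open Scope ring_scope.
Local Open Scope complex_scope.

(** Strict order is tested on elementary sets of [n + 2] projections, and a block of size at most
    [n + 1] contains no such set, so the hypothesis says nothing about such a block taken alone. The
    polynomial [S] detects these blocks by an identity instead. Its degree is [(n+1)^2 + 1] because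
    [S] is multilinear and alternating, hence vanishes on [M_r] once the degree exceeds the
    dimension [r^2]. Asymptotic multiplicativity rests on the Schwarz defect
    [phi (star y * y) - star (phi y) * phi y] at [y = psi a]: it is dominated by the defect of
    [phi o psi] at [a], which tends to [0]. The inequality [cpr <= hr] compares minimal projections
    with the units of their blocks. The C*-theory is derived from the norm axioms. Positivity is a
    norm condition, and square roots come from an iteration and commute with whatever commutes with
    the given element; this takes the place of spectral calculus. Gram vectors of a completely
    positive map take the place of its dilation. *)

Section NoncommutativeRing.
Variable R : pzRingType.

#[local] Instance nc_ops :
  @Ncring.Ring_ops R 0 1 +%R *%R (fun x y => x - y) -%R eq := {}.

#[local] Instance nc_ring : Ncring.Ring (Ro := nc_ops).
Proof.
split; rewrite /Algebra_syntax.equality /Ncring.eq_notation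
  /Algebra_syntax.addition /Ncring.add_notation
  /Algebra_syntax.multiplication /Ncring.mul_notation /=.
- exact: RelationClasses.eq_equivalence.
- by move=> x _ <- y _ <-.
- by move=> x _ <- y _ <-.
- by move=> x _ <- y _ <-.
- by move=> x _ <-.
- exact: add0r.
- exact: addrC.
- exact: addrA.
- exact: mul1r.
- exact: mulr1.
- exact: mulrA.
- by move=> x y z; exact: mulrDl.
- by move=> x y z; exact: mulrDr.
- by [].
- exact: subrr.
Qed.

End NoncommutativeRing.
#[local] Existing Instance nc_ops.
#[local] Existing Instance nc_ring.
Ltac ncring := Ncring_tac.non_commutative_ring.

(** * Star rings and the C*-norm *)

Section StarRing.
Variable A : starRingType.
Implicit Types x y : A.

Lemma star0 : star (0 : A) = 0.
Proof. by apply: (addIr (star 0)); rewrite -starD !add0r. Qed.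

Lemma starN x : star (- x) = - star x.
Proof. by apply: (addIr (star x)); rewrite -starD !addNr star0. Qed.

Lemma starB x y : star (x - y) = star x - star y.
Proof. by rewrite starD starN. Qed.

Lemma star1 : star (1 : A) = 1.
Proof. by rewrite -[RHS]starK -[star 1 in RHS]mulr1 starM starK mulr1. Qed.

Lemma star_sum I (r : seq I) (P : pred I) (f : I -> A) :
  star (\sum_(i <- r | P i) f i) = \sum_(i <- r | P i) star (f i).
Proof. exact: (big_morph _ (@starD A) star0). Qed.

Definition sa x := star x = x.

Lemma sa_mul x y : sa x -> sa y -> GRing.comm x y -> sa (x * y).
Proof. by rewrite /sa => xx yy c; rewrite starM xx yy c. Qed.

Lemma sa_starM x : sa (star x * x).
Proof. by rewrite /sa starM starK. Qed.

Lemma saD x y : sa x -> sa y -> sa (x + y).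
Proof. by rewrite /sa starD => -> ->. Qed.

Lemma saN x : sa x -> sa (- x).
Proof. by rewrite /sa starN => ->. Qed.

Lemma saB x y : sa x -> sa y -> sa (x - y).
Proof. by move=> ? ?; apply: saD => //; apply: saN. Qed.

Lemma sa_conj x y : sa x -> sa (star y * x * y).
Proof. by rewrite /sa !starM starK mulrA => ->. Qed.

End StarRing.

Section CstarNorm.
Variables (R : realType) (A : cstarAlgebra R).
Implicit Types (x y z : A) (c : R[i]) (t : R).

Lemma scaleAl c x y : c *: (x * y) = (c *: x) * y.
Proof. exact: cstar_scaleAl. Qed.

Lemma scaleAr c x y : c *: (x * y) = x * (c *: y).
Proof. exact: cstar_scaleAr. Qed.

Lemma starZ c x : star (c *: x) = c^* *: star x.
Proof. exact: cstar_starZ. Qed.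

Lemma starZr t x : star (t%:C *: x) = t%:C *: star x.
Proof. by rewrite starZ; congr (_ *: _); exact: conjc_real. Qed.

Lemma saZ t x : sa x -> sa (t%:C *: x).
Proof. by rewrite /sa starZr => ->. Qed.

Lemma comm_scale c x y : GRing.comm x y -> GRing.comm x (c *: y).
Proof. by rewrite /GRing.comm -scaleAl -scaleAr => ->. Qed.

Definition nrm x : R := complex.Re `|x|.

Lemma nrmE x : `|x| = (nrm x)%:C.
Proof. by rewrite /nrm RRe_real // normr_real. Qed.

Lemma nrm_ge0 x : 0 <= nrm x.
Proof. by rewrite -lecR -nrmE; exact: normr_ge0. Qed.

Lemma nrm0 : nrm 0 = 0.
Proof. by rewrite /nrm normr0. Qed.

Lemma nrm_eq0 x : nrm x = 0 -> x = 0.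
Proof. by move=> h; apply/eqP; rewrite -normr_eq0 nrmE h. Qed.

Lemma nrm_gt0 x : x <> 0 -> 0 < nrm x.
Proof.
move=> x0; rewrite lt_def nrm_ge0 andbT; apply/eqP => /nrm_eq0.
exact: x0.
Qed.

Lemma nrmD x y : nrm (x + y) <= nrm x + nrm y.
Proof. by rewrite -lecR rmorphD /= -!nrmE ler_normD. Qed.

Lemma nrmN x : nrm (- x) = nrm x.
Proof. by rewrite /nrm normrN. Qed.

Lemma nrmB x y : nrm (x - y) <= nrm x + nrm y.
Proof. by rewrite -(nrmN y) nrmD. Qed.

Lemma nrmZ t x : nrm (t%:C *: x) = `|t| * nrm x.
Proof.
apply: (@complexI R); rewrite rmorphM /= -!nrmE normrZ.
by rewrite normc_def /= expr0n addr0 sqrtr_sqr.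
Qed.

Lemma nrmM x y : nrm (x * y) <= nrm x * nrm y.
Proof. by rewrite -lecR rmorphM /= -!nrmE; exact: cstar_normM. Qed.

Lemma nrm_starM x : nrm (star x * x) = nrm x ^+ 2.
Proof.
apply: (@complexI R); rewrite rmorphXn /= -!nrmE.
exact: cstar_norm_star.
Qed.

(** The C*-identity gives [nrm y ^ 2 <= nrm (star y) * nrm y], hence one inequality, and [star] is
    an involution. *)
Lemma nrm_star x : nrm (star x) = nrm x.
Proof.
have le y : nrm y <= nrm (star y).
  have [->|/nrm_gt0 y0] := pselect (y = 0); first by rewrite star0.
  by rewrite -(ler_pM2r y0) -expr2 -nrm_starM nrmM.
by apply/le_anti; rewrite le -{2}(starK x) le.
Qed.

Lemma nrm1 : nrm 1 <= 1.
Proof.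
have := nrm_starM 1; rewrite star1 mul1r => h.
have := nrm_ge0 1; nra.
Qed.

Lemma starM_eq0 x : star x * x = 0 -> x = 0.
Proof.
move=> h; apply: nrm_eq0; apply/eqP; rewrite -sqrf_eq0 -nrm_starM h nrm0.
by [].
Qed.

Lemma Mstar_eq0 x : x * star x = 0 -> x = 0.
Proof.
by move=> h; rewrite -(starK x) (@starM_eq0 (star x)) ?star0 // starK.
Qed.

Lemma nrm_sqr x : sa x -> nrm (x * x) = nrm x ^+ 2.
Proof. by move=> xx; rewrite -nrm_starM xx. Qed.

Lemma sqr_eq0 x : sa x -> x * x = 0 -> x = 0.
Proof. by move=> xx; rewrite -{1}xx; exact: starM_eq0. Qed.

Lemma nrm_lim0 x : (forall e, 0 < e -> nrm x <= e) -> x = 0.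
Proof.
move=> h; apply: nrm_eq0; apply/le_anti; rewrite nrm_ge0 andbT.
by apply/ler_addgt0Pl => e e0; rewrite addr0 h.
Qed.

End CstarNorm.

(** * Square roots by iteration *)

Section Sqrt.
Variables (R : realType) (A : cstarAlgebra R).
Implicit Types (x y z h k w : A) (c : R[i]) (t e : R).

(** Domination by a bounded nondecreasing real sequence yields a Cauchy sequence without any rate of
    convergence; the iteration below offers no geometric rate when [nrm k = 1]. *)
Lemma nrm_complete (z : nat -> A) (t : nat -> R) (b : R) :
  (forall m n, (n <= m)%N -> nrm (z m - z n) <= t m - t n) ->
  (forall n, t n <= b) ->
  exists w, forall e, 0 < e ->
    exists N, forall n, (N <= n)%N -> nrm (w - z n) <= e.
Proof.
move=> zt tb.
have tcau e : 0 < e -> exists N, forall n, (N <= n)%N -> t n - t N < e.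
  move=> e0; have hs : has_sup (range t).
    by split; [exists (t 0%N), 0%N | exists b => _ [n _ <-]].
  have [_ [N _ <-] hN] := sup_adherent e0 hs.
  exists N => n _; have : t n <= sup (range t).
    by apply: ub_le_sup; [case: hs | exists n].
  lra.
have : cauchy ((z : nat -> cstar_space A) @ \oo).
  apply: cauchy_exP => E E0.
  have E_real : E = (complex.Re E)%:C by rewrite RRe_real // gtr0_real.
  have e0 : 0 < complex.Re E by rewrite -ltcR -E_real.
  have [N hN] := tcau _ e0.
  exists (z N), N => // n /= Nn; rewrite -ball_normE /= E_real.
  rewrite nrmE ltcR -nrmN opprB.
  by apply: le_lt_trans (zt _ _ Nn) _; exact: hN.
move=> /cauchy_cvg/cvg_ex[w zw]; exists w => e e0.
have eC : 0 < e%:C :> R[i] by rewrite ltcR.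
have [N _ hN] := (@cvgrPdist_lt _ _ _ _ _ _ _).1 zw _ eC.
by exists N => n /hN; rewrite /= nrmE ltcR => /ltW.
Qed.

(* With [t n] the iterates of the same recursion started from [k = 1], the
   increments of [z] are dominated by those of [t], which stays below 1. *)
Lemma sqrt_iteration k (h := 1 - k) : nrm k <= 1 -> sa k ->
  exists w, [/\ sa w, w * w = h, nrm (1 - w) <= 1 &
    forall y, GRing.comm y k -> GRing.comm y w].
Proof.
move=> k1 sak.
(* A fixed point [v = (k + v * v) / 2] satisfies [(1 - v) * (1 - v) = 1 - k]. *)
pose z := fix z n : A := if n is m.+1 then (2^-1)%:C *: (k + z m * z m) else 0.
pose t := fix t n : R := if n is m.+1 then 2^-1 * (1 + t m * t m) else 0.
have t01 n : 0 <= t n <= 1 by elim: n => [|n /andP[? ?]] /=; nra.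
have zt n : nrm (z n) <= t n.
  elim: n => [|n IH]; first by rewrite nrm0.
  rewrite [z _]/= [t _]/= nrmZ ger0_norm ?invr_ge0 //.
  rewrite ler_pM2l ?invr_gt0 //.
  apply: le_trans (nrmD _ _) _; apply: lerD => //.
  apply: le_trans (nrmM _ _) _; have := nrm_ge0 (z n); nra.
have zcomm y : GRing.comm y k -> forall n, GRing.comm y (z n).
  move=> yk; elim=> [|n IH]; first exact: commr0.
  by apply: comm_scale; apply: commrD => //; apply: commrM.
have zz n m : GRing.comm (z n) (z m).
  exact: (zcomm _ (commr_sym (zcomm _ (commr_refl k) n)) m).
have zsa n : sa (z n).
  elim: n => [|n IH]; first exact: star0.
  by apply: saZ; apply: saD => //; apply: sa_mul.
have step n : nrm (z n.+1 - z n) <= t n.+1 - t n.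
  elim: n => [|n IH].
    rewrite /= !mulr0 !addr0 !subr0 nrmZ ger0_norm ?invr_ge0 //.
    by rewrite ler_pM2l ?invr_gt0.
  have -> : z n.+2 - z n.+1 =
      (2^-1)%:C *: ((z n.+1 - z n) * (z n.+1 + z n)).
    transitivity ((2^-1)%:C *: (k + z n.+1 * z n.+1)
        - (2^-1)%:C *: (k + z n * z n)); first by [].
    rewrite -scalerBr; congr (_ *: _).
    move: (zz n n.+1); move: (z n) (z n.+1) => a b ab.
    have -> : (b - a) * (b + a) = b * b - a * a + (b * a - a * b) by ncring.
    by rewrite ab subrr; ncring.
  have -> : t n.+2 - t n.+1 = 2^-1 * ((t n.+1 - t n) * (t n.+1 + t n)).
    transitivity (2^-1 * (1 + t n.+1 * t n.+1) - 2^-1 * (1 + t n * t n)) => //.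
    ring.
  rewrite nrmZ ger0_norm ?invr_ge0 // ler_pM2l ?invr_gt0 //.
  apply: le_trans (nrmM _ _) _; apply: ler_pM => //; try exact: nrm_ge0.
  by apply: le_trans (nrmD _ _) _; apply: lerD.
have incr m n : (n <= m)%N -> nrm (z m - z n) <= t m - t n.
  move=> /subnK <-; elim: (m - n)%N => [|p IH].
    by rewrite !subrr nrm0.
  have -> : z (p.+1 + n)%N - z n =
      (z (p + n).+1 - z (p + n)%N) + (z (p + n)%N - z n) by ncring.
  apply: le_trans (nrmD _ _) _.
  by have := step (p + n)%N; rewrite -addSn; lra.
have [v vz] := nrm_complete incr (fun n => (andP (t01 n)).2).
(* Commutation, self-adjointness and the fixed point equation for the limit [v] all follow by
   bounding the respective defect by the distances from [v] to two consecutive iterates. *)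
have lim0 x (C : R) : 0 <= C ->
    (forall n, nrm x <= C * (nrm (v - z n) + nrm (v - z n.+1))) -> x = 0.
  move=> C0 hx; apply: nrm_lim0 => e e0.
  have f0 : 0 < e / (2 * C + 1) by apply: divr_gt0; lra.
  have [N hN] := vz _ f0; apply: le_trans (hx N) _.
  have := hN N (leqnn _); have := hN N.+1 (leqnSn _).
  have : e = e / (2 * C + 1) * (2 * C + 1) by field; lra.
  move: f0; set f := e / _; nra.
have vcomm y : GRing.comm y k -> GRing.comm y v.
  move=> yk; apply/eqP; rewrite -subr_eq0; apply/eqP.
  apply: (lim0 _ (2 * nrm y)) => [|n]; first by have := nrm_ge0 y; lra.
  have -> : y * v - v * y = y * (v - z n) - (v - z n) * y + (y * z n - z n * y).
    by ncring.
  rewrite zcomm // subrr addr0.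
  apply: le_trans (nrmB _ _) _.
  have := nrmM y (v - z n); have := nrmM (v - z n) y.
  have := nrm_ge0 y; have := nrm_ge0 (v - z n.+1); nra.
have sav : sa v.
  apply/eqP; rewrite -subr_eq0; apply/eqP.
  apply: (lim0 _ 2) => [|n]; first by lra.
  have -> : star v - v = star (v - z n) - (v - z n).
    by rewrite starB zsa; ncring.
  have := nrmB (star (v - z n)) (v - z n); rewrite nrm_star.
  by have := nrm_ge0 (v - z n.+1); lra.
have nv : nrm v <= 1.
  apply/ler_addgt0Pl => e e0; have [N /(_ _ (leqnn _)) hN] := vz _ e0.
  have -> : v = (v - z N) + z N by ncring.
  apply: le_trans (nrmD _ _) _; have := zt N; have /andP[_] := t01 N; lra.
have vE : v + v = k + v * v.
  apply/eqP; rewrite -subr_eq0; apply/eqP.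
  apply: (lim0 _ 2) => [|n]; first by lra.
  have -> : v + v - (k + v * v) = (v - z n.+1) + (v - z n.+1)
      - (v * (v - z n) + (v - z n) * z n) + (z n.+1 + z n.+1 - (k + z n * z n)).
    by ncring.
  have -> : z n.+1 + z n.+1 = k + z n * z n.
    by rewrite /= -scalerDl -rmorphD /= -{1 2}div1r -splitr scale1r.
  rewrite subrr addr0.
  have := nrmB ((v - z n.+1) + (v - z n.+1)) (v * (v - z n) + (v - z n) * z n).
  have := nrmD (v - z n.+1) (v - z n.+1).
  have := nrmD (v * (v - z n)) ((v - z n) * z n).
  have := nrmM v (v - z n); have := nrmM (v - z n) (z n).
  have := nrm_ge0 (v - z n); have := zt n; have /andP[_] := t01 n; nra.
exists (1 - v); split.
- by apply: saB => //; exact: star1.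
- have -> : (1 - v) * (1 - v) = 1 + v * v - (v + v) by ncring.
  by rewrite vE /h; ncring.
- by have -> : 1 - (1 - v) = v by ncring.
- by move=> y /vcomm yv; apply: commrB => //; exact: commr1.
Qed.

End Sqrt.

(** * Positive elements *)

Section Positive.
Variables (R : realType) (A : cstarAlgebra R).
Implicit Types (x y z h k w u v : A) (c : R[i]) (t e : R).

Lemma comm_scale1 c x : GRing.comm x (c *: (1 : A)).
Proof. exact: comm_scale (commr1 x). Qed.

Lemma nrm_Mstar x : nrm (x * star x) = nrm x ^+ 2.
Proof. by rewrite -{1}(starK x) nrm_starM nrm_star. Qed.

Lemma sa1 : sa (1 : A).
Proof. exact: star1. Qed.

Lemma nrm_scale1 t : 0 <= t -> nrm (t%:C *: (1 : A)) <= t.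
Proof.
by move=> t0; rewrite nrmZ ger0_norm // ler_piMr // nrm1.
Qed.

(* Positivity in terms of the norm, for which sums of positive elements are
   immediate. *)
Definition pos h := sa h /\ exists2 t, 0 <= t & nrm (t%:C *: (1 : A) - h) <= t.

Lemma pos0 : pos 0.
Proof.
split; first exact: star0.
by exists 0 => //; rewrite subr0 scale0r nrm0.
Qed.

Lemma posD h k : pos h -> pos k -> pos (h + k).
Proof.
move=> [sh [s s0 hs]] [sk [t t0 kt]]; split; first exact: saD.
exists (s + t); first by rewrite addr_ge0.
rewrite rmorphD /= scalerDl.
have -> : s%:C *: (1 : A) + t%:C *: (1 : A) - (h + k) =
  (s%:C *: (1 : A) - h) + (t%:C *: (1 : A) - k) by ncring.
by apply: le_trans (nrmD _ _) _; apply: lerD.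
Qed.

Lemma pos_sum I (r : seq I) (P : pred I) (f : I -> A) :
  (forall i, P i -> pos (f i)) -> pos (\sum_(i <- r | P i) f i).
Proof. by move=> hf; apply: (big_ind pos pos0 posD). Qed.

Lemma posZ t h : 0 <= t -> pos h -> pos (t%:C *: h).
Proof.
move=> t0 [sh [s s0 hs]]; split; first exact: saZ.
exists (t * s); first exact: mulr_ge0.
rewrite rmorphM /= -scalerA -scalerBr nrmZ ger0_norm //.
exact: ler_wpM2l.
Qed.

Lemma pos_normB t x : sa x -> nrm x <= t -> pos (t%:C *: (1 : A) - x).
Proof.
move=> sx xt; split; first by apply: saB => //; apply: saZ; exact: sa1.
exists t; first exact: le_trans (nrm_ge0 x) xt.
by have -> : t%:C *: (1 : A) - (t%:C *: (1 : A) - x) = x by ncring.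
Qed.

(** After scaling by the constant [t] of positivity, [h / t = 1 - k] with [nrm k <= 1], where the
    iteration applies. *)
Lemma pos_sqrt h : pos h -> exists w,
  [/\ pos w, w * w = h & forall y, GRing.comm y h -> GRing.comm y w].
Proof.
move=> [sh [t t0 ht]].
have [tz|tN0] := eqVneq t 0.
  have -> : h = 0.
    apply: nrm_eq0; apply/le_anti; rewrite nrm_ge0 andbT.
    by move: ht; rewrite tz scale0r sub0r nrmN.
  by exists 0; split; [exact: pos0 | rewrite mulr0 | move=> y _; exact: commr0].
have tp : 0 < t by rewrite lt_def tN0.
pose k := 1 - (t^-1)%:C *: h.
have kE : k = (t^-1)%:C *: (t%:C *: (1 : A) - h).
  by rewrite scalerBr scalerA -rmorphM /= mulVf ?gt_eqF // scale1r.
have k1 : nrm k <= 1.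
  by rewrite kE nrmZ ger0_norm ?invr_ge0 // ler_pdivrMl // mulr1.
have sk : sa k by apply: saB; [exact: sa1 | exact: saZ].
have [w [sw ww w1 wc]] := sqrt_iteration k1 sk.
exists ((Num.sqrt t)%:C *: w); split.
- split; first exact: saZ.
  exists (Num.sqrt t); first exact: sqrtr_ge0.
  by rewrite -scalerBr nrmZ ger0_norm ?sqrtr_ge0 // ler_piMr // sqrtr_ge0.
- rewrite -scaleAl -scaleAr scalerA -rmorphM /= -expr2 sqr_sqrtr // ww.
  have -> : 1 - k = (t^-1)%:C *: h by rewrite /k; ncring.
  by rewrite scalerA -rmorphM /= mulfV ?gt_eqF // scale1r.
- move=> y yh; apply: comm_scale; apply: wc; apply: commrB; first exact: commr1.
  exact: comm_scale.
Qed.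

(** The element [u = l + i k] satisfies [star u * u = l * l + k * k], and [l] is its real part. *)
Lemma sumsq_nrm l k t : sa l -> sa k -> GRing.comm l k ->
  l * l + k * k = t%:C *: (1 : A) -> 0 <= t -> nrm (l : A) ^+ 2 <= t.
Proof.
move=> sl sk lk lkt t0.
pose u := l + 'i%C *: k.
have us : star u = l - 'i%C *: k.
  rewrite starD starZ sl sk; congr (_ + _); rewrite -scaleNr; congr (_ *: _).
  by apply/eqP; rewrite eq_complex /= oppr0 !eqxx.
have uu : star u * u = t%:C *: (1 : A).
  rewrite us -lkt /u.
  have -> : (l - 'i%C *: k) * (l + 'i%C *: k) = l * l + (l * ('i%C *: k) -
    ('i%C *: k) * l) - ('i%C *: k) * ('i%C *: k) by ncring.
  rewrite -!scaleAl -!scaleAr lk subrr addr0 scalerA.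
  have -> : 'i%C * 'i%C = -1 :> R[i] by rewrite -expr2 sqr_i.
  by rewrite scaleN1r opprK.
have u2 : nrm u ^+ 2 <= t by rewrite -nrm_starM uu nrm_scale1.
have l2 : 2 * nrm l <= 2 * nrm u.
  have -> : 2 * nrm l = nrm (u + star u).
    rewrite us /u; have -> : l + 'i%C *: k + (l - 'i%C *: k) = l + l by ncring.
    rewrite -[l in RHS]scale1r -scalerDl (_ : 1 + 1 = 2%:R%:C).
      by rewrite nrmZ ger0_norm.
    by rewrite rmorph_nat.
  by have := nrmD u (star u); rewrite nrm_star; lra.
have := nrm_ge0 l; nra.
Qed.

(** The root [v] of [t - w * w] commutes with [w], and [w * w + v * v = t] bounds [v * v]. *)
Lemma sqr_le t w : sa w -> nrm (w * w) <= t -> nrm (t%:C *: (1 : A) - w * w) <= t.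
Proof.
move=> sw wt.
have t0 : 0 <= t := le_trans (nrm_ge0 _) wt.
have sww : sa (w * w) by exact: sa_mul.
have [v [pv vv vc]] := pos_sqrt (pos_normB sww wt).
rewrite -vv nrm_sqr; last by case: pv.
apply: (@sumsq_nrm _ w) => //; first by case: pv.
- apply: commr_sym; apply: vc; apply: commrB; first exact: comm_scale1.
  by apply: commrM.
- by rewrite vv; ncring.
Qed.

Lemma pos_sqr w : sa w -> pos (w * w).
Proof.
move=> sw; split; first exact: sa_mul.
by exists (nrm (w * w)); [exact: nrm_ge0 | exact: sqr_le].
Qed.

Lemma pos_le h t : pos h -> nrm h <= t -> nrm (t%:C *: (1 : A) - h) <= t.
Proof. by move=> /pos_sqrt[w [[sw _] <- _]]; exact: sqr_le. Qed.

Lemma pos_sa h : pos h -> sa h. Proof. by case. Qed.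

(** The constant in the definition of positivity depends on the element. By [pos_le] the common
    value [nrm h + 1] serves all nearby positive elements, so the norm inequality passes to the
    limit. *)
Lemma pos_closed h :
  (forall e, 0 < e -> exists2 k, pos k & nrm (h - k) <= e) -> pos h.
Proof.
move=> hk; split.
  apply/eqP; rewrite -subr_eq0; apply/eqP; apply: nrm_lim0 => e e0.
  have e20 : 0 < e / 2 by lra.
  have [k [sk _] hke] := hk _ e20.
  have -> : star h - h = star (h - k) - (h - k) by rewrite starB sk; ncring.
  by apply: le_trans (nrmB _ _) _; rewrite nrm_star; lra.
exists (nrm h + 1); first by have := nrm_ge0 h; lra.
apply/ler_addgt0Pl => e e0.
have f0 : 0 < Num.min 1 e by rewrite lt_min ltr01.
have [k pk] := hk _ f0; rewrite le_min => /andP[k1 ke].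
have kn : nrm k <= nrm h + 1.
  have -> : k = h - (h - k) by ncring.
  by apply: le_trans (nrmB _ _) _; rewrite lerD2l.
have := pos_le pk kn.
have -> : (nrm h + 1)%:C *: (1 : A) - h =
  ((nrm h + 1)%:C *: (1 : A) - k) - (h - k) by ncring.
have := nrmB ((nrm h + 1)%:C *: (1 : A) - k) (h - k); lra.
Qed.

Lemma pos_commM h k : pos h -> pos k -> GRing.comm h k -> pos (h * k).
Proof.
move=> ph pk hk.
have [w [pw ww wc]] := pos_sqrt ph; have [v [pv vv vc]] := pos_sqrt pk.
have wk : GRing.comm w k by apply: commr_sym; apply: wc; exact: commr_sym.
have wv : GRing.comm w v by exact: vc.
have -> : h * k = (w * v) * (w * v).
  by rewrite -ww -vv -!mulrA; congr (w * _); rewrite !mulrA wv.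
by apply: pos_sqr; apply: sa_mul; [case: pw | case: pv | ].
Qed.

(** The roots of [h] and [- h] commute and their squares add up to [0]. *)
Lemma pos_antisym h : pos h -> pos (- h) -> h = 0.
Proof.
move=> ph pnh.
have [w [[sw _] ww wc]] := pos_sqrt ph; have [v [[sv _] vv vc]] := pos_sqrt pnh.
have wh : GRing.comm w h by rewrite -ww; apply: commrM.
have wv : GRing.comm w v by apply: vc; exact: commrN.
have w0 : nrm w ^+ 2 <= 0.
  apply: (sumsq_nrm sw sv wv) => //.
  by rewrite ww vv subrr scale0r.
have wz : w = 0 by apply: nrm_eq0; have := nrm_ge0 w; nra.
by rewrite -ww wz mul0r.
Qed.

Lemma pos_le_nrm u t : pos u -> pos (t%:C *: (1 : A) - u) -> 0 <= t -> nrm u <= t.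
Proof.
move=> pu ptu t0.
have [l [[sl _] ll lc]] := pos_sqrt pu; have [k [[sk _] kk kc]] := pos_sqrt ptu.
rewrite -ll nrm_sqr //; apply: (sumsq_nrm sl sk) => //.
  apply: kc; apply: commrB; first exact: comm_scale1.
  by rewrite -ll; apply: commrM.
by rewrite ll kk; ncring.
Qed.

Lemma pos_nrm_mono u v : pos u -> pos v -> nrm u <= nrm (u + v).
Proof.
move=> pu pv; apply: pos_le_nrm => //; last exact: nrm_ge0.
have -> : (nrm (u + v))%:C *: (1 : A) - u = ((nrm (u + v))%:C *: (1 : A) - (u + v)) + v.
  by ncring.
apply: posD => //; apply: pos_normB => //.
by apply: pos_sa; apply: posD.
Qed.

(* With [g] the absolute value of [p] and [y = g - p], both [y g y] and
   [- y (p + q) y] turn out to be half of [y^3]. *)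
Lemma pos_part p q : sa p -> sa q -> p * q = 0 -> pos (p + q) -> pos (p : A).
Proof.
move=> sp sq pq pb.
have qp : q * p = 0 by rewrite -sp -sq -starM pq star0.
have [g [pg gg gc]] := pos_sqrt (pos_sqr sp).
have sg := pos_sa pg.
have gp : GRing.comm g p by apply: commr_sym; apply: gc; apply: commrM.
have gq : g * q = 0.
  apply: starM_eq0; rewrite starM sg sq.
  have -> : q * g * (g * q) = q * (g * g) * q by rewrite !mulrA.
  by rewrite gg mulrA qp !mul0r.
have qg : q * g = 0 by rewrite -sg -sq -starM gq star0.
pose y := g - p.
have sy : sa y by apply: saB.
have py : p * y = - (g * y).
  by rewrite /y !mulrBr gg -gp opprB.
have yy : y * y = g * y + g * y.
  by rewrite {1}/y mulrBl py opprK.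
have yg : y * g = g * y by rewrite /y mulrBr mulrBl gp.
have qy : q * y = 0 by rewrite /y mulrBr qg qp subrr.
have gE : g = p + y by rewrite addrC subrK.
clearbody y.
have yp : y * p = - (y * g) by rewrite -sy -sp -starM py starN starM sy sg.
have yq : y * q = 0 by rewrite -sy -sq -starM qy star0.
have p1 : pos (y * y * g).
  apply: pos_commM => //; first exact: pos_sqr.
  by apply: commr_sym; apply: commrM.
have y3 : y * y * (p + q) = - (y * y * g).
  by rewrite -!mulrA mulrDr yp yq addr0 mulrN.
have ypq : GRing.comm y (p + q).
  by rewrite /GRing.comm mulrDr mulrDl yp yq py qy !addr0 yg.
have p2 : pos (- (y * y * g)).
  rewrite -y3; apply: pos_commM => //; first exact: pos_sqr.
  by apply: commr_sym; apply: commrM; apply: commr_sym.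
have yyg : y * y * g = 0 by exact: pos_antisym p1 p2.
have y40 : y * y * (y * y) = 0.
  by rewrite {2}yy mulrDr !mulrA yyg !mul0r addr0.
have yy0 : y * y = 0 by apply: sqr_eq0 => //; exact: sa_mul.
have y0 : y = 0 by exact: sqr_eq0.
by move: pg; rewrite gE y0 addr0.
Qed.

(** With [b] the absolute value of [x], half of [b + x] and half of [b - x] are orthogonal with
    positive sum [b], so [pos_part] applies to both. *)
Lemma pos_neg_parts x : sa x ->
  exists p q, [/\ pos p, pos q, p * q = 0, q * p = 0 & x = p - q].
Proof.
move=> sx; have [b [pb bb bc]] := pos_sqrt (pos_sqr sx).
have sb := pos_sa pb.
have bx : GRing.comm b x by apply: commr_sym; apply: bc; apply: commrM.
pose p := (2^-1)%:C *: (b + x); pose q := (2^-1)%:C *: (b - x).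
have sp : sa p by apply: saZ; apply: saD.
have sq : sa q by apply: saZ; apply: saB.
have half y : (2^-1)%:C *: (y + y) = y.
  by rewrite scalerDr -scalerDl -rmorphD /= -{1 2}div1r -splitr scale1r.
have pq : p * q = 0.
  rewrite -scaleAl -scaleAr.
  have -> : (b + x) * (b - x) = b * b - x * x - (b * x - x * b) by ncring.
  by rewrite bb bx !subrr !scaler0.
have qp : q * p = 0 by rewrite -sp -sq -starM pq star0.
have pqb : p + q = b.
  rewrite /p /q -scalerDr; have -> : b + x + (b - x) = b + b by ncring.
  exact: half.
exists p, q; split => //.
- by apply: (pos_part sp sq) => //; rewrite pqb.
- by apply: (pos_part sq sp) => //; rewrite addrC pqb.
- rewrite /p /q -scalerBr; have -> : b + x - (b - x) = x + x by ncring.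
  by rewrite half.
Qed.

(* If [-y^*y] and [yy^*] are positive and [m = |y|^2], then
   [y(m + g) = (m - f)y] with [g = -y^*y], [f = yy^*], and comparing norms
   gives [2m^3 <= m^3]. *)
Lemma pos_swap_eq0 y : pos (- (star y * y)) -> pos (y * star y) -> y = 0.
Proof.
move=> pg pf; apply: nrm_eq0.
pose g := - (star y * y); pose m := nrm y ^+ 2; pose M := m%:C *: (1 : A).
have m0 : 0 <= m by exact: sqr_ge0.
have gm : nrm g = m by rewrite nrmN nrm_starM.
have sg : sa g := pos_sa pg.
have Mc z : GRing.comm M z by apply: commr_sym; exact: comm_scale1.
have sM : sa M by apply: saZ; exact: sa1.
have E : y * (M + g) = (M - y * star y) * y.
  by rewrite mulrDr mulrBl Mc mulrN !mulrA.
have up : nrm (y * (M + g)) <= m * nrm y.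
  rewrite E; apply: le_trans (nrmM _ _) _; apply: ler_wpM2r; first exact: nrm_ge0.
  by apply: pos_le => //; rewrite nrm_Mstar.
have lo : 2 * m * m ^+ 2 <= nrm (y * (M + g)) ^+ 2.
  rewrite -nrm_starM starM saD //.
  have -> : (M + g) * star y * (y * (M + g)) =
     - (((m + m)%:C *: (g * g)) + (M * g * M + g * g * g)).
    have -> : (m + m)%:C *: (g * g) = M * (g * g) + M * (g * g).
      by rewrite -!scaleAl !mul1r rmorphD /= scalerDl.
    have -> : (M + g) * star y * (y * (M + g)) = - ((M + g) * g * (M + g)).
      by rewrite /g; ncring.
    have -> : (M + g) * g * (M + g) =
        M * (g * g) + g * g * M + (M * g * M + g * g * g).
      by ncring.
    by rewrite -[g * g * M]Mc.
  rewrite nrmN; apply: le_trans (pos_nrm_mono _ _).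
  - rewrite nrmZ nrm_sqr // gm ger0_norm; last by rewrite addr_ge0.
    lra.
  - by apply: posZ; [rewrite addr_ge0 | exact: pos_sqr].
  - have pM : pos M.
      by rewrite -[M]subr0; apply: pos_normB; [exact: star0 | rewrite nrm0].
    apply: posD.
      rewrite Mc -mulrA; apply: pos_commM => //; first exact: pos_sqr.
      by apply: commrM; apply: commr_sym; exact: Mc.
    apply: pos_commM => //; first exact: pos_sqr.
    by apply: commr_sym; apply: commrM.
have m3 : 2 * m * m ^+ 2 <= m * m ^+ 2.
  apply: le_trans lo _.
  have -> : m * m ^+ 2 = (m * nrm y) ^+ 2 by rewrite [RHS]exprMn [LHS]mulrC.
  rewrite ler_pXn2r // ?nnegrE ?nrm_ge0 //.
  by apply: mulr_ge0 => //; exact: nrm_ge0.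
have mz : m = 0.
  apply/le_anti; rewrite m0 andbT leNgt; apply/negP => mp.
  have : 0 < m * m ^+ 2 by apply: mulr_gt0 => //; exact: exprn_gt0.
  by move: m3; rewrite -mulrA; lra.
by apply/eqP; rewrite -sqrf_eq0 -/m mz.
Qed.

(** Write [star x * x = p - q] and [y = x * q]. Then [- (star y * y) = q * q * q] is positive, and
    so is [y * star y], being half of a sum of two squares plus [- (star y * y)]. By [pos_swap_eq0],
    [y = 0], hence [q = 0]. *)
Lemma pos_starM x : pos (star x * x).
Proof.
have [p [q [pp pq pq0 qp0 xE]]] := pos_neg_parts (sa_starM x).
have sq := pos_sa pq.
pose y := x * q.
have yE : star y * y = - (q * q * q).
  rewrite starM sq; have -> : q * star x * (x * q) = q * (star x * x) * q.
    by rewrite !mulrA.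
  by rewrite xE mulrBr qp0 sub0r mulNr.
have p1 : pos (- (star y * y)).
  rewrite yE opprK; apply: pos_commM => //; first exact: pos_sqr.
  by apply: commr_sym; apply: commrM.
pose u := y + star y; pose v := 'i%C *: (y - star y).
have su : sa u by rewrite /sa starD starK addrC.
have sv : sa v.
  rewrite /sa starZ starB starK -[X in _ = X]opprK -scalerN -scaleNr opprB.
  by congr (_ *: _); apply/eqP; rewrite eq_complex /= oppr0 !eqxx.
have uv : u * u + v * v = (star y * y + y * star y) + (star y * y + y * star y).
  rewrite -scaleAl -scaleAr scalerA.
  have -> : 'i%C * 'i%C = -1 :> R[i] by rewrite -expr2 sqr_i.
  by rewrite scaleN1r /u; ncring.
have p2 : pos (y * star y).
  have -> : y * star y = (2^-1)%:C *: (u * u + v * v) + - (star y * y).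
    rewrite uv scalerDr -scalerDl -rmorphD /= -{1 2}div1r -splitr scale1r.
    by ncring.
  apply: posD => //; apply: posZ; first by rewrite invr_ge0.
  by apply: posD; exact: pos_sqr.
have y0 := pos_swap_eq0 p1 p2.
have q3 : q * q * (q * q) = 0.
  by rewrite mulrA -[q * q * q]opprK -yE y0 mulr0 oppr0 mul0r.
have q0 : q = 0.
  by apply: sqr_eq0 => //; apply: sqr_eq0 => //; exact: sa_mul.
by rewrite xE q0 subr0.
Qed.

Lemma pos_conj h x : pos h -> pos (star x * h * x).
Proof.
move=> /pos_sqrt[w [[sw _] <- _]].
have -> : star x * (w * w) * x = star (w * x) * (w * x).
  by rewrite starM sw !mulrA.
exact: pos_starM.
Qed.

Lemma pos_add_eq0 u v : pos u -> pos v -> u + v = 0 -> u = 0.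
Proof.
move=> pu pv uv; apply: nrm_eq0; apply/le_anti; rewrite nrm_ge0 andbT.
by rewrite (le_trans (pos_nrm_mono pu pv)) // uv nrm0.
Qed.

Lemma pos_conj_eq0 h x : pos h -> star x * h * x = 0 -> h * x = 0.
Proof.
move=> /pos_sqrt[w [[sw _] <- _]] h0; rewrite -mulrA.
rewrite (@starM_eq0 _ _ (w * x)) ?mulr0 // starM sw.
by move: h0; rewrite !mulrA.
Qed.

(** Conjugation by [x] turns the equation into a vanishing sum of two positive elements, each of
    which must vanish. *)
Lemma pos_addM_eq0 h k x : pos h -> pos k -> (h + k) * x = 0 -> h * x = 0.
Proof.
move=> ph pk hkx; apply: pos_conj_eq0 => //.
apply: (pos_add_eq0 (pos_conj x ph) (pos_conj x pk)).
by rewrite -mulrDl -mulrDr -mulrA hkx mulr0.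
Qed.

End Positive.

(** * Completely positive maps *)

Section InnerProduct.
Variables (R : realType) (A : cstarAlgebra R) (m : nat).
Implicit Types (f g : 'I_m -> A) (c d x y : A).

(** The inner product of the right Hilbert module [A^m], linear in the second argument. *)
Definition ip f g := \sum_(k < m) star (f k) * g k.

Lemma star_ip f g : star (ip f g) = ip g f.
Proof.
by rewrite star_sum; apply: eq_bigr => k _; rewrite starM starK.
Qed.

Lemma pos_ip f : pos (ip f f).
Proof. by apply: pos_sum => k _; exact: pos_starM. Qed.

Lemma ip_subr f g h d :
  ip f (fun k => g k - h k * d) = ip f g - ip f h * d.
Proof.
rewrite /ip mulr_suml -sumrB; apply: eq_bigr => k _.
by rewrite mulrBr mulrA.
Qed.

Lemma ip_subl f g h d :
  ip (fun k => g k - h k * d) f = ip g f - star d * ip h f.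
Proof. by rewrite -[LHS]starK star_ip ip_subr starB starM !star_ip. Qed.

(** With [d = ip f g / b] and [h = g - f d], the element [ip g g] is [b (star d * d)] plus two
    positive terms, and the norm is monotone on positive elements. *)
Lemma ip_cauchy_schwarz f g (b : R) : 0 < b -> nrm (ip f f) <= b ->
  nrm (ip f g) ^+ 2 <= b * nrm (ip g g).
Proof.
move=> b0 fb; pose c := ip f g; pose d : A := (b^-1)%:C *: c.
have cd : c = b%:C *: d.
  by rewrite /d scalerA -rmorphM /= mulfV ?gt_eqF // scale1r.
have dd : nrm d = b^-1 * nrm c by rewrite nrmZ ger0_norm // invr_ge0 ltW.
have pB : pos (b%:C *: (1 : A) - ip f f).
  by apply: pos_normB => //; apply: pos_sa; exact: pos_ip.
pose h k := g k - f k * d.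
have E : ip g g = b%:C *: (star d * d) +
    (ip h h + star d * (b%:C *: (1 : A) - ip f f) * d).
  have -> : ip h h = ip g g - star d * c - (star c - star d * ip f f) * d.
    by rewrite ip_subr !ip_subl -(star_ip f g).
  have -> : star d * (b%:C *: (1 : A) - ip f f) = b%:C *: star d - star d * ip f f.
    by rewrite mulrBr -scaleAr mulr1.
  have -> : star d * c = b%:C *: (star d * d) by rewrite {1}cd scaleAr.
  have -> : star c = b%:C *: star d by rewrite {1}cd starZr.
  by rewrite !mulrBl -!scaleAl; ncring.
have := pos_nrm_mono (posZ (ltW b0) (pos_starM d))
  (posD (pos_ip h) (pos_conj d pB)).
rewrite -E nrmZ nrm_starM ger0_norm; last exact: ltW.
rewrite dd exprMn.
move=> le1; have -> : nrm c ^+ 2 = b * (b * (b^-1 ^+ 2 * nrm c ^+ 2)).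
  by field; rewrite gt_eqF.
by apply: ler_wpM2l => //; exact: ltW.
Qed.

End InnerProduct.

Section CompletelyPositiveMaps.
Variables (R : realType) (F A : cstarAlgebra R).
Implicit Types (phi : {linear F -> A}).

Lemma cpc_nrm phi x : cpc phi -> nrm (phi x) <= nrm x.
Proof. by case=> _ /(_ x); rewrite !nrmE lecR. Qed.

(** The matrix of the [star (v i) * v j] is positive: it comes from the matrix [V] with first row
    [v] and zeros below. Its image factors in the same way, and the columns of that factor are the
    Gram vectors [w i]. *)
Lemma cp_gram (phi : F -> A) n (v : 'I_n.+1 -> F) : completely_positive phi ->
  exists w : 'I_n.+1 -> 'I_n.+1 -> A,
    forall i j, ip (w i) (w j) = phi (star (v i) * v j).
Proof.
move=> cp.
pose V : 'M[F]_n.+1 := \matrix_(i, j) (if i == ord0 then v j else 0).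
have [y Ey] := cp _ _ (ex_intro _ V erefl).
exists (fun i k => y k i) => i j.
have := congr1 (fun M : 'M[A]_n.+1 => M i j) Ey.
rewrite !mxE big_ord_recl big1 => [|k _]; last by rewrite !mxE mulr0.
rewrite !mxE /= addr0 => ->.
by apply: eq_bigr => k _; rewrite !mxE.
Qed.

Lemma cp_star (phi : F -> A) x : completely_positive phi ->
  phi (star x) = star (phi x).
Proof.
move=> cp.
have [w hw] := @cp_gram phi 1 (fun i => if i == ord0 then 1 else x) cp.
have := hw ord0 ord_max; have := hw ord_max ord0.
by rewrite /= star1 mulr1 mul1r => <- <-; rewrite star_ip.
Qed.

Lemma cp_pos (phi : F -> A) x : completely_positive phi -> pos x -> pos (phi x).
Proof.
move=> cp /pos_sqrt[w [[sw _] <- _]].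
have [y hy] := @cp_gram phi 0 (fun=> w) cp.
by rewrite -{1}sw -(hy ord0 ord0); exact: pos_ip.
Qed.

(** Take Gram vectors of [1], [star x] and [y], and let [h] be the third minus the first times
    [phi y]. Then [phi (x * y) - phi x * phi y] is the inner product of the second with [h], while
    [ip h h] is dominated by the Schwarz defect of [y]; Cauchy-Schwarz gives the estimate. *)
Lemma cpc_defect phi y : cpc phi ->
  pos (phi (star y * y) - star (phi y) * phi y) /\
  forall x (b : R), 0 < b -> nrm x ^+ 2 <= b ->
    nrm (phi (x * y) - phi x * phi y) ^+ 2 <=
    b * nrm (phi (star y * y) - star (phi y) * phi y).
Proof.
move=> cpphi; have cp := cpphi.1.
have p1 : pos (1 - phi 1).
  have -> : 1 = (1 : R)%:C *: (1 : A) by rewrite scale1r.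
  apply: pos_normB; first by rewrite /sa -cp_star // star1.
  exact: le_trans (cpc_nrm _ cpphi) (nrm1 _).
have main x : exists m (f h : 'I_m -> A),
    [/\ ip f f = phi (x * star x), ip f h = phi (x * y) - phi x * phi y &
      phi (star y * y) - star (phi y) * phi y =
        ip h h + star (phi y) * (1 - phi 1) * phi y].
  have [w hw] := @cp_gram phi 2
    (fun i => if i == ord0 then 1 else if i == ord_max then y else star x) cp.
  pose i1 := inord 1 : 'I_3.
  have e1 : (i1 == ord0 :> 'I_3) = false by rewrite -val_eqE /= inordK.
  have e2 : (i1 == ord_max :> 'I_3) = false by rewrite -val_eqE /= inordK.
  exists _, (w i1), (fun k => w ord_max k - w ord0 k * phi y).
  rewrite ip_subr ip_subr ip_subl !ip_subl !hw e1 e2 /= star1 !mul1r !mulr1 starK.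
  rewrite (cp_star y cp); split => //; ncring.
split.
  have [m [f [h [_ _ ->]]]] := main 0.
  by apply: posD; [exact: pos_ip | exact: pos_conj].
move=> x b b0 xb; have [m [f [h [ff fh ->]]]] := main x.
rewrite -fh; apply: le_trans (ip_cauchy_schwarz _ b0 _) _.
  by rewrite ff (le_trans (cpc_nrm _ cpphi)) // nrm_Mstar.
apply: ler_wpM2l; first exact: ltW.
by apply: pos_nrm_mono; [exact: pos_ip | exact: pos_conj].
Qed.

End CompletelyPositiveMaps.

(** The defect of [phi] at [psi a] is dominated by that of the composite at [a]: they differ by the
    image under [phi] of the defect of [psi], which is positive. *)
Lemma approx_multiplicative (R : realType) (A F : cstarAlgebra R)
    (psi : {linear A -> F}) (phi : {linear F -> A}) (x : F) (a : A) (b : R) :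
  cpc psi -> cpc phi -> 0 < b -> nrm x ^+ 2 <= b ->
  nrm (phi (x * psi a) - phi x * phi (psi a)) ^+ 2 <=
    b * nrm (phi (psi (star a * a)) - star (phi (psi a)) * phi (psi a)).
Proof.
move=> cpsi cphi b0 xb.
have [pd _] := cpc_defect a cpsi; have [pd' est] := cpc_defect (psi a) cphi.
apply: le_trans (est x b b0 xb) _; apply: ler_wpM2l; first exact: ltW.
have -> : phi (psi (star a * a)) - star (phi (psi a)) * phi (psi a) =
    (phi (star (psi a) * psi a) - star (phi (psi a)) * phi (psi a)) +
    phi (psi (star a * a) - star (psi a) * psi a).
  by rewrite linearB /=; ncring.
by apply: pos_nrm_mono => //; apply: cp_pos => //; case: cphi.
Qed.

(** * Algebras with boundedly many orthogonal elements *)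

Section OrthogonalFamilies.
Variables (R : realType) (A : cstarAlgebra R).
Implicit Types (x y z : A) (t : R).

Definition orth_family m (x : 'I_m -> A) :=
  [/\ forall i, sa (x i), forall i, x i <> 0 &
    forall i j, i != j -> x i * x j = 0].

Definition orth_to_others m (x : 'I_m -> A) i y :=
  sa y /\ forall j, j != i -> y * x j = 0.

Lemma pos_orth (p q y : A) : pos p -> pos q -> p * q = 0 -> (p - q) * y = 0 ->
  p * y = 0.
Proof.
move=> pp pq pq0 y0; have sp := pos_sa pp; apply: starM_eq0.
rewrite starM sp -mulrA.
have E : p * y = q * y by apply/eqP; rewrite -subr_eq0 -mulrBl y0.
by rewrite E [p * _]mulrA pq0 mul0r mulr0.
Qed.

Lemma scale_between (c : R[i]) x y z : x * (c *: y) * z = c *: (x * y * z).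
Proof. by rewrite -scaleAr -scaleAl. Qed.

Lemma sa_decomp x : exists u v : A, [/\ sa u, sa v & x = u + 'i%C *: v].
Proof.
pose u := (2^-1)%:C *: (x + star x).
pose v := (2^-1)%:C *: ((- 'i%C) *: (x - star x)).
exists u, v; split.
- by apply: saZ; rewrite /sa starD starK addrC.
- apply: saZ; rewrite /sa starZ starB starK -[X in _ = X]opprK -scalerN.
  rewrite -scaleNr opprB opprK; congr (_ *: _).
  by apply/eqP; rewrite eq_complex /= oppr0 !opprK !eqxx.
- rewrite /u /v scalerA mulrC -scalerA -scalerDr scalerA mulrN -expr2 sqr_i.
  rewrite opprK scale1r.
  have -> : x + star x + (x - star x) = x + x by ncring.
  by rewrite scalerDr -scalerDl -rmorphD /= -{1 2}div1r -splitr scale1r.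
Qed.

(* A positive multiple of [- k] is approximated by the positive
   [- t k +- z], [t] large. *)
Lemma pos_archimedean k z : pos k -> (forall t, pos (z - t%:C *: k)) -> k = 0.
Proof.
move=> pk h; apply: pos_antisym => //; apply: pos_closed => e e0.
have nz := nrm_ge0 z.
pose t := (nrm z + 1) / e; have t0 : 0 < t by apply: divr_gt0; lra.
exists ((t^-1)%:C *: (z - t%:C *: k)); first by apply: posZ => //; rewrite invr_ge0 ltW.
rewrite scalerBr scalerA -rmorphM /= mulVf ?gt_eqF // scale1r.
have -> : - k - ((t^-1)%:C *: z - k) = - ((t^-1)%:C *: z) by ncring.
rewrite nrmN nrmZ ger0_norm ?invr_ge0; last exact: ltW.
rewrite ler_pdivrMl // /t mulrAC -mulrA mulfV ?gt_eqF // mulr1; lra.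
Qed.

Section MaximalFamily.
Variables (m : nat) (x : 'I_m -> A).
Hypothesis xfam : orth_family x.
Hypothesis xmax : forall y : 'I_m.+1 -> A, ~ orth_family y.
Implicit Types i j : 'I_m.

(** Otherwise replacing [x i] by [y] and appending [z] would give an orthogonal family with [m + 1]
    members. *)
Lemma orth_to_others_dichotomy i y z :
  orth_to_others x i y -> orth_to_others x i z -> y * z = 0 -> y = 0 \/ z = 0.
Proof.
move=> [sy yx] [sz zx] yz; have [sx x0 xx] := xfam.
have [|y0] := pselect (y = 0); first by left.
have [|z0] := pselect (z = 0); first by right.
have zy : z * y = 0 by rewrite -sy -sz -starM yz star0.
have xy j : j != i -> x j * y = 0.
  by move=> /yx h; rewrite -sy -(sx j) -starM h star0.
have xz j : j != i -> x j * z = 0.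
  by move=> /zx h; rewrite -sz -(sx j) -starM h star0.
pose f (k : 'I_m.+1) : A := if unlift ord_max k is Some j then
  if j == i then y else x j else z.
suff : orth_family f by move/xmax.
rewrite /f; split.
- by move=> k; case: unliftP => // j _; case: eqP.
- by move=> k; case: unliftP => // j _; case: eqP.
- move=> k l; case: unliftP => [j|] ->; case: unliftP => [j'|] ->.
  + rewrite (inj_eq lift_inj); case: (eqVneq j i) => [->|ji].
      by case: (eqVneq j' i) => // j'i _; exact: yx.
    by case: (eqVneq j' i) => [->|j'i] jj'; [exact: xy | exact: xx].
  + by case: (eqVneq j i) => // ji _; exact: xz.
  + by case: (eqVneq j' i) => // ji _; exact: zx.
  + by rewrite eqxx.
Qed.

(** The positive and negative parts of [z] are again orthogonal to the other members, and to each
    other, so one of them is [0]. *)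
Lemma orth_to_others_pos i z : orth_to_others x i z -> pos z \/ pos (- z).
Proof.
move=> [sz zx]; have [p [q [pp pq pq0 qp0 zE]]] := pos_neg_parts sz.
have op : orth_to_others x i p.
  split; first exact: pos_sa.
  by move=> j /zx; rewrite zE; exact: pos_orth.
have oq : orth_to_others x i q.
  split; first exact: pos_sa.
  move=> j /zx zj; apply: (pos_orth pq pp qp0).
  by rewrite -opprB -zE mulNr zj oppr0.
case: (orth_to_others_dichotomy op oq pq0) => h.
  by right; rewrite zE h sub0r opprK.
by left; rewrite zE h subr0.
Qed.

Lemma orth_to_othersB i y z t : orth_to_others x i y -> orth_to_others x i z ->
  orth_to_others x i (y - t%:C *: z).
Proof.
move=> [sy yx] [sz zx]; split; first by apply: saB => //; exact: saZ.
by move=> j ji; rewrite mulrBl -scaleAl yx // zx // scaler0 subrr.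
Qed.

(** Each [z - t k] is positive or negative, so the [t] for which it is positive form a Dedekind cut.
    At the supremum it is both, because positivity is a closed condition. *)
Lemma orth_to_others_line i k z : orth_to_others x i k -> pos k -> k <> 0 ->
  orth_to_others x i z -> exists t, z = t%:C *: k.
Proof.
move=> ok pk k0 oz.
have dich t : pos (z - t%:C *: k) \/ pos (t%:C *: k - z).
  by have := orth_to_others_pos (orth_to_othersB t oz ok); rewrite opprB.
pose S := [set t | pos (z - t%:C *: k)].
have Sdown t t' : t' <= t -> S t -> S t'.
  move=> tt St; rewrite /S /=.
  have -> : z - t'%:C *: k = (z - t%:C *: k) + (t - t')%:C *: k.
    by rewrite rmorphB /= scalerBl; ncring.
  by apply: posD => //; apply: posZ => //; rewrite subr_ge0.
have [t1 t1S] : exists t, ~ S t.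
  apply: contrapT => /forallNP h; apply: k0; apply: (pos_archimedean pk) => t.
  by apply: contrapT; exact: h.
have S0 : S !=set0.
  apply: contrapT => /forallNP h; apply: k0.
  apply: (@pos_archimedean k (- z)) => // t.
  have [/h[]|] := dich (- t).
  by rewrite rmorphN /= scaleNr addrC.
have hS : has_sup S.
  split => //; exists t1 => t St; rewrite leNgt; apply/negP => /ltW h.
  exact/t1S/(Sdown _ _ h).
have nk := nrm_ge0 k.
have near e : 0 < e -> exists2 d : R, 0 < d & d * nrm k <= e.
  move=> e0; exists (e / (nrm k + 1)); first by apply: divr_gt0; lra.
  by rewrite mulrAC ler_pdivrMr; [nra | lra].
exists (sup S); apply/eqP; rewrite -subr_eq0; apply/eqP; apply: pos_antisym.
- apply: pos_closed => e e0; have [d d0 de] := near e e0.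
  have [t St td] := sup_adherent d0 hS.
  have ts : t <= sup S by apply: ub_le_sup => //; case: hS.
  exists (z - t%:C *: k) => //.
  have -> : z - (sup S)%:C *: k - (z - t%:C *: k) = - ((sup S - t)%:C *: k).
    by rewrite rmorphB /= scalerBl; ncring.
  by rewrite nrmN nrmZ ger0_norm ?subr_ge0 //; nra.
- apply: pos_closed => e e0; have [d d0 de] := near e e0.
  have [St|pt] := dich (sup S + d).
    have : sup S + d <= sup S by apply: ub_le_sup => //; case: hS.
    lra.
  exists ((sup S + d)%:C *: k - z) => //.
  have -> : - (z - (sup S)%:C *: k) - ((sup S + d)%:C *: k - z) = - (d%:C *: k).
    by rewrite rmorphD /= scalerDl; ncring.
  by rewrite nrmN nrmZ ger0_norm // ltW.
Qed.

End MaximalFamily.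

(** In a general C*-algebra this is stronger than minimality of the projection [e]; it is the form
    from which matrix coefficients can be extracted. *)
Definition scalar_corner (e : A) :=
  [/\ sa e, e * e = e, e <> 0 & forall a, exists c : R[i], e * a * e = c *: e].

(** For a maximal family, [k = x i * x i] satisfies that [k A k] lies in [C k], so a multiple of [k]
    is a projection with scalar corner. Maximality also forces the complement of the sum of these
    projections to vanish. *)
Lemma bounded_orth_families n :
  (forall x : 'I_n -> A, ~ orth_family x) ->
  exists m (e : 'I_m -> A), [/\ forall i, scalar_corner (e i),
    forall i j, i != j -> e i * e j = 0 & \sum_i e i = 1].
Proof.
move=> xn.
have [m [x xfam] xmax] : exists2 m, exists x : 'I_m -> A, orth_family x &
    forall y : 'I_m.+1 -> A, ~ orth_family y.
  pose P m := `[< exists x : 'I_m -> A, orth_family x >].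
  have exP : exists m, P m.
    by exists 0%N; apply/asboolP; exists (fun=> 0); split; case.
  have bP m : P m -> (m <= n)%N.
    move=> /asboolP[x [sx x0 xx]]; rewrite leqNgt; apply/negP => nm.
    apply: (xn (x \o widen_ord (ltnW nm))); split => i /=; [exact: sx | exact: x0 |].
    by move=> j ij; apply: xx.
  have [m /asboolP hm mmax] := ex_maxnP exP bP.
  exists m => // y fy; have /mmax : P m.+1 by apply/asboolP; exists y.
  by rewrite ltnn.
have [sx x0 xx] := xfam.
have corner i : exists e : A,
    scalar_corner e /\ exists t : R, e = t%:C *: (x i * x i).
  pose k := x i * x i.
  have pk : pos k by exact: pos_sqr.
  have k0 : k <> 0 by move/(sqr_eq0 (sx i)); exact: x0.
  have kx j : j != i -> k * x j = 0.
    by move=> ji; rewrite -mulrA xx ?mulr0 // eq_sym.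
  have ok : orth_to_others x i k by split; [exact: pos_sa|].
  have okk a : sa a -> orth_to_others x i (k * a * k).
    move=> sa_a; split; last by move=> j ji; rewrite -mulrA kx // mulr0.
    by rewrite -{1}(pos_sa pk); exact: sa_conj.
  (* Taking [a = 1] gives [k * k = t k], so [k / t] is idempotent. *)
  have [t kk] := orth_to_others_line xfam xmax ok pk k0 (okk 1 (star1 _)).
  have t0 : t != 0.
    apply/eqP => t0; apply: k0; apply: sqr_eq0; first exact: pos_sa.
    by move: kk; rewrite mulr1 t0 scale0r.
  have tV u : (t^-1)%:C *: (t%:C *: u) = u :> A.
    by rewrite scalerA -rmorphM /= mulVf // scale1r.
  pose e := (t^-1)%:C *: k.
  exists e; split; last by exists t^-1.
  split.
  - by apply: saZ; exact: pos_sa.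
  - rewrite -scaleAl -scaleAr; move: kk; rewrite mulr1 => ->.
    by rewrite tV.
  - move=> e0; apply: k0.
    by rewrite -(tV k) scalerA mulrC -scalerA [X in _ *: X]e0 scaler0.
  - have sae a : sa a -> exists c : R[i], e * a * e = c *: e.
      move=> sa_a; have [u E] := orth_to_others_line xfam xmax ok pk k0 (okk a sa_a).
      exists (t^-1 * u)%:C; rewrite /e -!scaleAl -scaleAr E.
      by rewrite !scalerA -!rmorphM /=; congr (_%:C *: _); ring.
    move=> a; have [u [v [su sv ->]]] := sa_decomp a.
    have [c cu] := sae u su; have [d dv] := sae v sv.
    exists (c + 'i%C * d).
    by rewrite mulrDr mulrDl scale_between cu dv scalerDl scalerA.
have [e he] := choice corner.
have e0 i j : i != j -> e i * e j = 0.
  move=> ij.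
  have [[_ [t ->]] [_ [u ->]]] := (he i, he j).
  by rewrite -scaleAl -scaleAr mulrA -(mulrA (x i)) xx // mulr0 mul0r !scaler0.
exists m, e; split => //; first by move=> i; case: (he i).
pose q := 1 - \sum_i e i.
have eq0 i : q * e i = 0.
  rewrite mulrBl mul1r mulr_suml (bigD1 i) //= big1 ?addr0.
    by have [[_ -> _ _] _] := he i; rewrite subrr.
  by move=> j ji; exact: e0.
apply/esym/eqP; rewrite -subr_eq0 -/q; apply/eqP; apply: contrapT => q0.
have sq : sa q.
  apply: saB; first exact: star1.
  by rewrite /sa star_sum; apply: eq_bigr => i _; have [[-> _ _ _] _] := he i.
pose f (k : 'I_m.+1) : A := if unlift ord_max k is Some j then e j else q.
apply: (xmax f); rewrite /f; split.
- by move=> k; case: unliftP => // j _; have [[]] := he j.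
- by move=> k; case: unliftP => // j _; have [[]] := he j.
- move=> k l; case: unliftP => [j|] ->; case: unliftP => [j'|] ->.
  + by rewrite (inj_eq lift_inj); exact: e0.
  + move=> _; have [[sj _ _ _] _] := he j.
    by rewrite -sj -sq -starM eq0 star0.
  + by move=> _; exact: eq0.
  + by rewrite eqxx.
Qed.

End OrthogonalFamilies.

(** * Partial isometries and matrix units *)

Section PartialIsometries.
Variables (R : realType) (A : cstarAlgebra R).
Implicit Types (e f x y : A).

Lemma scalar_corner_scale e (c d : R[i]) : scalar_corner e -> c *: e = d *: e ->
  c = d.
Proof.
move=> [_ _ e0 _] /eqP; rewrite -subr_eq0 -scalerBl scaler_eq0 subr_eq0.
by case/orP => /eqP.
Qed.

(** For [z = e * x * f], the element [star z * z] is a positive multiple of [f], so [z] can be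
    normalized to [v]. Then [v * star v] is a nonzero idempotent among the multiples of [e], hence
    [e]. *)
Lemma scalar_corner_isometry e f x : scalar_corner e -> scalar_corner f ->
  e * x * f <> 0 ->
  exists v, [/\ e * v = v, v * f = v, star v * v = f & v * star v = e].
Proof.
move=> ce cf; have [se ee e0 ec] := ce; have [sf ff f0 fc] := cf.
set z := e * x * f => z0.
have ez : e * z = z by rewrite /z !mulrA ee.
have zf : z * f = z by rewrite /z -!mulrA ff.
have [c zz] : exists c : R[i], star z * z = c *: f.
  have [c E] := fc (star x * e * e * x); exists c; rewrite -E.
  by rewrite /z !starM se sf !mulrA.
have [t cE] : exists t : R, c = t%:C.
  exists (complex.Re c); rewrite RRe_real //.
  have := sa_starM z; rewrite /sa zz starZ sf.
  by move/(scalar_corner_scale cf)/CrealP.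
have t0 : 0 < t.
  rewrite ltNge; apply/negP => t0; apply: z0; apply: starM_eq0.
  apply: pos_antisym (pos_starM z) _.
  rewrite zz cE -scaleNr -rmorphN /=; apply: posZ; first by rewrite oppr_ge0.
  by rewrite -ff; exact: pos_sqr.
pose s := Num.sqrt t; have s0 : 0 < s by rewrite sqrtr_gt0.
pose v := (s^-1)%:C *: z.
have ev : e * v = v by rewrite -scaleAr ez.
have vf : v * f = v by rewrite -scaleAl zf.
have vv : star v * v = f.
  rewrite starZr -scaleAl -scaleAr zz cE !scalerA -!rmorphM /=.
  have -> : s^-1 * s^-1 * t = 1.
    by rewrite -[t]sqr_sqrtr ?ltW // -/s; field; rewrite gt_eqF.
  by rewrite scale1r.
exists v; split => //.
have [d vvd] : exists d : R[i], v * star v = d *: e.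
  have [d E] := ec (v * star v); exists d; rewrite -E.
  by rewrite mulrA ev -mulrA -{1}se -starM ev.
have dd : d * d = d.
  have : v * star v * (v * star v) = v * star v.
    by rewrite mulrA -(mulrA v) vv vf.
  by rewrite vvd -scaleAl -scaleAr ee scalerA => /(scalar_corner_scale ce).
have : d != 0.
  apply/eqP => d0; apply: f0; rewrite -vv.
  by rewrite (@Mstar_eq0 _ _ v) ?mulr0 // vvd d0 scale0r.
move=> d0; rewrite vvd (_ : d = 1) ?scale1r //.
by apply: (mulfI d0); rewrite mulr1.
Qed.

End PartialIsometries.

Section MatrixUnits.
Variables (R : realType) (A : cstarAlgebra R) (s : nat) (r : 'I_s -> nat).
Variables (w : forall t, 'I_(r t) -> A) (f : 'I_s -> A).
Hypothesis fcorner : forall t, scalar_corner (f t).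
Hypothesis ww : forall t (k l : 'I_(r t)), star (w k) * w l = if k == l then f t else 0.
Hypothesis w0 : forall t t' k l y, t != t' ->
  star (@w t k) * y * @w t' l = 0.
Hypothesis wf : forall t k, @w t k * f t = @w t k.
Hypothesis w1 : \sum_t \sum_k @w t k * star (@w t k) = 1.

(** For each [t] the [w k] are partial isometries with the common initial projection [f t], so the
    [w k * star (w l)] are matrix units. *)
Definition from_matrices (x : forall t, 'M[R[i]]_(r t)) : A :=
  \sum_t \sum_k \sum_l x t k l *: (@w t k * star (@w t l)).

Lemma from_matricesK x t (k l : 'I_(r t)) :
  star (@w t k) * from_matrices x * w l = x t k l *: f t.
Proof.
rewrite mulr_sumr mulr_suml (bigD1 t) //= [X in _ + X]big1 ?addr0; last first.
  move=> t' tt'; rewrite mulr_sumr mulr_suml big1 // => k' _.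
  rewrite mulr_sumr mulr_suml big1 // => l' _.
  rewrite scale_between [_ * (_ * _)]mulrA -[star (w k)]mulr1 w0 ?mul0r ?scaler0 //.
  by rewrite eq_sym.
rewrite mulr_sumr mulr_suml (bigD1 k) //= [X in _ + X]big1 ?addr0; last first.
  move=> k' kk'; rewrite mulr_sumr mulr_suml big1 // => l' _.
  by rewrite scale_between mulrA ww eq_sym (negbTE kk') !mul0r scaler0.
rewrite mulr_sumr mulr_suml (bigD1 l) //= [X in _ + X]big1 ?addr0; last first.
  move=> l' ll'.
  by rewrite scale_between -!mulrA ww (negbTE ll') !mulr0 scaler0.
have [_ ff _ _] := fcorner t.
by rewrite scale_between mulrA ww eqxx -mulrA ww eqxx ff.
Qed.

(** The compressions [star (w k) * y * w l] are multiples of [f t], and they determine [y] because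
    the range projections [w k * star (w k)] sum to [1]. The algebraic identities are checked on
    them. *)
Lemma from_matrices_iso : direct_sum_iso from_matrices.
Proof.
have coef y t (k l : 'I_(r t)) : exists c : R[i], star (@w t k) * y * w l = c *: f t.
  have [_ ff _ fc] := fcorner t; have [sf _ _ _] := fcorner t.
  have [c E] := fc (star (w k) * y * w l); exists c; rewrite -E.
  by rewrite -{1}(wf k) -{1}(wf l) starM sf !mulrA.
pose g y t : 'M[R[i]]_(r t) := \matrix_(k, l) projT1 (cid (coef y t k l)).
have gE y t (k l : 'I_(r t)) : star (@w t k) * y * w l = g y t k l *: f t.
  by rewrite mxE; case: cid.
have gK : cancel g from_matrices.
  move=> y; rewrite -[RHS]mul1r -[RHS]mulr1 -w1 mulr_suml mulr_suml.
  apply: eq_bigr => t _; rewrite mulr_suml mulr_suml; apply: eq_bigr => k _.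
  rewrite mulr_sumr (bigD1 t) //= [X in _ = _ + X]big1 ?addr0; last first.
    move=> t' tt'; rewrite mulr_sumr big1 // => l _.
    have -> : w k * star (w k) * y * (w l * star (w l)) =
      w k * (star (w k) * y * w l) * star (w l) by rewrite !mulrA.
    by rewrite w0 ?mulr0 ?mul0r // eq_sym.
  rewrite mulr_sumr; apply: eq_bigr => l _.
  have -> : w k * star (w k) * y * (w l * star (w l)) =
    w k * (star (w k) * y * w l) * star (w l) by rewrite !mulrA.
  by rewrite gE -scaleAr wf scaleAl.
have fK : cancel from_matrices g.
  move=> x; apply: functional_extensionality_dep => t; apply/matrixP => k l.
  apply: (scalar_corner_scale (fcorner t)).
  by rewrite -gE from_matricesK.
have inj y z : (forall t (k l : 'I_(r t)),
    star (@w t k) * y * w l = star (@w t k) * z * w l) -> y = z.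
  move=> yz; rewrite -(gK y) -(gK z); congr from_matrices.
  apply: functional_extensionality_dep => t; apply/matrixP => k l.
  by apply: (scalar_corner_scale (fcorner t)); rewrite -!gE.
split.
- by exists g.
- move=> c x y; apply: inj => t k l.
  rewrite from_matricesK mulrDr mulrDl scale_between !from_matricesK !mxE.
  by rewrite scalerDl scalerA.
- move=> x y; apply: inj => t k l.
  have -> : star (w k) * (from_matrices x * from_matrices y) * w l =
    star (w k) * from_matrices x * 1 * (from_matrices y * w l).
    by rewrite mulr1 !mulrA.
  rewrite from_matricesK -w1 mulr_sumr mulr_suml (bigD1 t) //=.
  rewrite [X in _ + X]big1 ?addr0; last first.
    move=> t' tt'; rewrite mulr_sumr mulr_suml big1 // => j _.
    by rewrite [_ * (w j * _)]mulrA w0 ?mul0r // eq_sym.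
  rewrite mxE mulr_sumr mulr_suml scaler_suml; apply: eq_bigr => j _.
  rewrite [_ * (w j * _)]mulrA from_matricesK.
  have -> : x t k j *: f t * star (w j) * (from_matrices y * w l) =
    x t k j *: (f t * (star (w j) * from_matrices y * w l)).
    by rewrite -!scaleAl !mulrA.
  have [_ ff _ _] := fcorner t.
  by rewrite from_matricesK -scaleAr ff scalerA.
- move=> x; apply: inj => t k l; rewrite from_matricesK.
  have -> : star (w k) * star (from_matrices x) * w l =
    star (star (w l) * from_matrices x * w k).
    by rewrite !starM starK !mulrA.
  by rewrite from_matricesK starZ !mxE; have [-> _ _ _] := fcorner t.
Qed.

End MatrixUnits.

(** Two of the projections are linked when some element of [A] connects them, and then a partial
    isometry does. Linkage is an equivalence relation, and each class yields one matrix block. *)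
Theorem bounded_orth_direct_sum (R : realType) (A : cstarAlgebra R) n :
  (forall x : 'I_n -> A, ~ orth_family x) ->
  exists s (r : 'I_s -> nat) (Theta : (forall i, 'M[R[i]]_(r i)) -> A),
    (forall i, (0 < r i)%N) /\ direct_sum_iso Theta.
Proof.
move=> /bounded_orth_families[m [e [ce e0 e1]]].
pose linked i j := `[< exists x, e i * x * e j <> 0 >].
have iso i j : linked i j -> exists v, [/\ e i * v = v, v * e j = v,
    star v * v = e j & v * star v = e i].
  by move=> /asboolP[x hx]; exact: scalar_corner_isometry hx.
have eN0 i : e i <> 0 by case: (ce i).
have se i : star (e i) = e i by case: (ce i).
have ee i : e i * e i = e i by case: (ce i).
have linked_refl i : linked i i.
  by apply/asboolP; exists 1; rewrite mulr1 ee.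
have linked_sym i j : linked i j -> linked j i.
  move=> /asboolP[x hx]; apply/asboolP; exists (star x) => h; apply: hx.
  rewrite -[LHS]starK -[RHS]star0; congr star.
  by rewrite !starM !se mulrA.
have linked_trans i j k : linked i j -> linked j k -> linked i k.
  move=> /iso[v [ev ve vv _]] /iso[u [eu ue _ uu]].
  apply/asboolP; exists (v * u) => h; apply: (eN0 j).
  have vu0 : v * u = 0 by rewrite -h mulrA ev -mulrA ue.
  by rewrite -[LHS]ee -{1}vv -uu -mulrA (mulrA v) vu0 mul0r mulr0.
(* A canonical representative of the class of [i]; the default never occurs, since [i] is linked to
   itself. *)
pose c i := odflt i [pick j | linked i j].
have linked_c i : linked i (c i).
  by rewrite /c; case: pickP => //= h; rewrite -(h i) linked_refl.
have cP i j : linked i j -> c i = c j.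
  move=> ij; rewrite /c (eq_pick (_ : linked i =1 linked j)).
    by case: pickP => //= h; have := linked_refl j; rewrite h.
  move=> k; apply/idP/idP; first exact/linked_trans/linked_sym.
  exact: linked_trans.
have unlinked i j x : c i != c j -> e i * x * e j = 0.
  move=> cij; apply: contrapT => h; move/eqP: cij; apply; apply: cP.
  by apply/asboolP; exists x.
have [v hv] := choice (fun i => iso _ _ (linked_c i)).
pose C := [set c i | i : 'I_m]%SET.
pose D (t : 'I_#|C|) := [set i | c i == enum_val t]%SET.
pose r (t : 'I_#|C|) := #|D t|.
pose w t (k : 'I_(r t)) : A := v (enum_val k).
have wc t (k : 'I_(r t)) : c (enum_val k) = enum_val t.
  by have := enum_valP k; rewrite inE => /eqP.
exists #|C|, r, (from_matrices w); split.
  move=> t; have /imsetP[i _ ti] := enum_valP t.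
  by apply/card_gt0P; exists i; rewrite inE ti.
have vE i : v i = e i * v i * e (c i) by have [-> ->] := hv i.
have v0 i j y : c i != c j -> star (v i) * y * v j = 0.
  move=> cij; rewrite vE [v j]vE !starM !se.
  have -> : e (c i) * (star (v i) * e i) * y * (e j * v j * e (c j)) =
    e (c i) * star (v i) * (e i * y * e j) * v j * e (c j) by rewrite !mulrA.
  by rewrite unlinked // mulr0 !mul0r.
apply: (@from_matrices_iso _ _ _ _ w (fun t => e (enum_val t))).
- by move=> t; exact: ce.
- move=> t k l; case: eqP => [<-|/eqP kl].
    by have [_ _ -> _] := hv (enum_val k); rewrite wc.
  rewrite /w; have [<- _ _ _] := hv (enum_val k).
  have [<- _ _ _] := hv (enum_val l).
  rewrite starM se -mulrA (mulrA (e _)) e0 ?mul0r ?mulr0 //.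
  by apply: contra kl => /eqP/enum_val_inj ->.
- move=> t t' k l y tt'; apply: v0; rewrite !wc.
  by apply: contra tt' => /eqP/enum_val_inj ->.
- by move=> t k; rewrite -(wc t k); have [_ -> _ _] := hv (enum_val k).
- rewrite -e1 (partition_big c (fun j => j \in C)) /=; last first.
    by move=> i _; exact: imset_f.
  rewrite (big_enum_val (fun j => \sum_(i | c i == j) e i)) /=.
  apply: eq_bigr => t _.
  rewrite (eq_bigl (fun i => i \in D t)); last by move=> i; rewrite inE.
  rewrite [RHS]big_enum_val; apply: eq_bigr => k _.
  by have [_ _ _ ->] := hv (enum_val k).
Qed.

(** * Finite-dimensional algebras and direct sums of matrix blocks *)

Section FiniteDimension.
Variable R : realType.

(** Nonzero orthogonal self-adjoint elements are linearly independent: multiplying a relation by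
    [x i] leaves a multiple of [x i * x i], itself nonzero. *)
Lemma finite_dimensional_orth (F : cstarAlgebra R) : finite_dimensional F ->
  exists n, forall x : 'I_n -> F, ~ orth_family x.
Proof.
move=> [n [b hb]]; exists n.+1 => x [sx x0 xx].
have [c hc] := choice (fun i => hb (x i)).
pose M : 'M[R[i]]_(n.+1, n) := \matrix_(i, j) c i j.
have : kermx M != 0.
  rewrite kermx_eq0 /row_free; apply/negP => /eqP h.
  by have := rank_leq_col M; rewrite h ltnn.
move=> /rowV0Pn[v /sub_kermxP vM /rV0Pn[i vi]].
have v0 : \sum_k v 0 k *: x k = 0.
  transitivity (\sum_j (v *m M) 0 j *: b j).
    under eq_bigr do rewrite hc scaler_sumr.
    rewrite exchange_big; apply: eq_bigr => j _; rewrite mxE scaler_suml.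
    by apply: eq_bigr => k _; rewrite mxE scalerA.
  by rewrite vM big1 // => j _; rewrite mxE scale0r.
apply: (x0 i); apply: sqr_eq0 => //.
have /eqP : (\sum_k v 0 k *: x k) * x i = 0 by rewrite v0 mul0r.
rewrite mulr_suml (bigD1 i) //= big1 ?addr0; last first.
  by move=> k ki; rewrite -scaleAl xx // scaler0.
by rewrite -scaleAl scaler_eq0 (negbTE vi) => /eqP.
Qed.

End FiniteDimension.

Section DirectSum.
Variables (R : realType) (A : cstarAlgebra R) (s : nat) (r : 'I_s -> nat).
Variable Th : (forall i, 'M[R[i]]_(r i)) -> A.
Hypothesis iso : direct_sum_iso Th.
Implicit Types x y : forall i, 'M[R[i]]_(r i).

Lemma direct_sum0 : Th (fun=> 0) = 0.
Proof.
have [_ lin _ _] := iso; apply: (addrI (Th (fun=> 0))).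
rewrite addr0 -{1}[Th _]scale1r -lin; congr Th.
by apply: functional_extensionality_dep => i; rewrite scaler0 addr0.
Qed.

Lemma direct_sumD x y : Th (fun i => x i + y i) = Th x + Th y.
Proof.
have [_ lin _ _] := iso; rewrite -[Th x]scale1r -lin; congr Th.
by apply: functional_extensionality_dep => i; rewrite scale1r.
Qed.

Lemma direct_sumZ (c : R[i]) x : Th (fun i => c *: x i) = c *: Th x.
Proof.
have [_ lin _ _] := iso; rewrite -[RHS]addr0 -direct_sum0 -lin; congr Th.
by apply: functional_extensionality_dep => i; rewrite addr0.
Qed.

Lemma direct_sum_sum I (t : seq I) (f : I -> forall i, 'M[R[i]]_(r i)) :
  Th (fun i => \sum_(k <- t) f k i) = \sum_(k <- t) Th (f k).
Proof.
elim: t => [|k t IH].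
  rewrite big_nil -direct_sum0; congr Th.
  by apply: functional_extensionality_dep => i; rewrite big_nil.
rewrite big_cons -IH -direct_sumD; congr Th.
by apply: functional_extensionality_dep => i; rewrite big_cons.
Qed.

Lemma direct_sum1 : Th (fun=> 1) = 1.
Proof.
have [[g _ gK] _ mul _] := iso.
rewrite -[RHS](gK 1) -[LHS]mulr1 -[X in _ * X](gK 1) -mul; congr Th.
by apply: functional_extensionality_dep => i; rewrite mul1r.
Qed.

Definition block i (M : 'M[R[i]]_(r i)) : A := Th (summand M).

Lemma summand_in i (M : 'M[R[i]]_(r i)) : summand M i = M.
Proof. exact: dfwith_in. Qed.

Lemma summand_out i (M : 'M[R[i]]_(r i)) j : i != j -> summand M j = 0.
Proof. exact: dfwith_out. Qed.

Lemma block_sum I (t : seq I) i (M : I -> 'M[R[i]]_(r i)) :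
  block (\sum_(k <- t) M k) = \sum_(k <- t) block (M k).
Proof.
rewrite -direct_sum_sum; congr Th; apply: functional_extensionality_dep => j.
have [<-|ij] := eqVneq i j.
  by rewrite summand_in; apply: eq_bigr => k _; rewrite summand_in.
by rewrite summand_out // big1 // => k _; rewrite summand_out.
Qed.

Lemma blockZ i (c : R[i]) (M : 'M[R[i]]_(r i)) : block (c *: M) = c *: block M.
Proof.
rewrite -direct_sumZ; congr Th; apply: functional_extensionality_dep => j.
by have [<-|ij] := eqVneq i j; rewrite ?summand_in // !summand_out // scaler0.
Qed.

Lemma blockD i (M N : 'M[R[i]]_(r i)) : block (M + N) = block M + block N.
Proof.
rewrite -direct_sumD; congr Th; apply: functional_extensionality_dep => j.
by have [<-|ij] := eqVneq i j; rewrite ?summand_in // !summand_out // addr0.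
Qed.

Lemma block0 i : block (0 : 'M[R[i]]_(r i)) = 0.
Proof. by rewrite -(scale0r 0) blockZ scale0r. Qed.

Lemma blockM i (M N : 'M[R[i]]_(r i)) : block (M * N) = block M * block N.
Proof.
have [_ _ mul _] := iso.
rewrite -mul; congr Th; apply: functional_extensionality_dep => j.
by have [<-|ij] := eqVneq i j; rewrite ?summand_in // !summand_out // mulr0.
Qed.

Lemma blockM0 i j (M : 'M[R[i]]_(r i)) (N : 'M[R[i]]_(r j)) : i != j ->
  block M * block N = 0.
Proof.
have [_ _ mul _] := iso => ij; rewrite -mul -direct_sum0; congr Th.
apply: functional_extensionality_dep => k.
have [ik|ik] := eqVneq i k; last by rewrite summand_out // mul0r.
by rewrite [X in _ * X]summand_out ?mulr0 // -ik eq_sym.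
Qed.

Lemma block_star i (M : 'M[R[i]]_(r i)) : block (star M) = star (block M).
Proof.
have [_ _ _ st] := iso.
rewrite -st; congr Th; apply: functional_extensionality_dep => j.
by have [<-|ij] := eqVneq i j; rewrite ?summand_in // !summand_out // star0.
Qed.

Lemma block_inj i : injective (@block i).
Proof.
have [[g thK _] _ _ _] := iso => M N /(congr1 g); rewrite !thK => MN.
by rewrite -(summand_in M) MN summand_in.
Qed.

Lemma direct_sum_block x : Th x = \sum_i block (x i).
Proof.
rewrite -direct_sum_sum; congr Th; apply: functional_extensionality_dep => j.
rewrite (bigD1 j) //= summand_in big1 ?addr0 // => i ij.
by rewrite summand_out.
Qed.

Lemma direct_sum_finite_dimensional : finite_dimensional A.
Proof.
have [[g _ gK] _ _ _] := iso.
pose T := {i : 'I_s & ('I_(r i) * 'I_(r i))%type} : finType.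
pose E i (q : 'I_(r i) * 'I_(r i)) := block (delta_mx q.1 q.2).
pose c (y : A) (p : T) := g y (tag p) (tagged p).1 (tagged p).2.
exists #|T|, (fun k => let p := enum_val k in E (tag p) (tagged p)) => y.
exists (fun k => c y (enum_val k)).
rewrite -(big_enum_val (fun p : T => c y p *: E (tag p) (tagged p))) /=.
rewrite -{1}[y]gK direct_sum_block.
transitivity (\sum_i \sum_(q : 'I_(r i) * 'I_(r i)) g y i q.1 q.2 *: E i q).
  apply: eq_bigr => i _; rewrite {1}[g y i]matrix_sum_delta pair_bigA /=.
  by rewrite block_sum; apply: eq_bigr => q _; rewrite blockZ.
by rewrite (sig_big_dep xpredT (fun i => xpredT)
  (fun i (q : 'I_(r i) * 'I_(r i)) => g y i q.1 q.2 *: E i q)).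
Qed.

End DirectSum.

(** * Standard polynomials *)

Section StandardPolynomial.
Variable B : pzRingType.

Definition standard_poly d (a : 'I_d -> B) : B :=
  \sum_(s : 'S_d) (-1) ^+ s * \prod_(i < d) a (s i).

(** Composition with the transposition of [k] and [l] flips every sign and changes no product. In
    characteristic [0] the conclusion means that the polynomial vanishes. *)
Lemma standard_poly_alt d (a : 'I_d -> B) k l : k != l -> a k = a l ->
  standard_poly a = - standard_poly a.
Proof.
move=> kl akl; rewrite {1}/standard_poly (reindex_inj (mulIg (tperm k l))) /=.
rewrite -sumrN; apply: eq_bigr => s _.
rewrite odd_permM odd_tperm kl addbT signrN mulNr; congr (- (_ * _)).
apply: eq_bigr => i _; rewrite permM.
by case: tpermP => // ->.
Qed.

(* [x_0 a_0 x_1, x_1 a_1 x_2, ...] multiply to something nonzero only in the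
   given order. *)
Lemma standard_poly_chain d (x a : nat -> B) :
  (forall i j, (i <= d)%N -> (j <= d)%N -> i <> j -> x i * x j = 0) ->
  standard_poly (fun i : 'I_d => x i * a i * x i.+1) =
  \prod_(0 <= k < d) (x k * a k * x k.+1).
Proof.
move=> xx; pose y k := x k * a k * x k.+1.
rewrite /standard_poly (bigD1 1%g) //= odd_perm1 mul1r [X in _ + X]big1 ?addr0.
  by rewrite big_mkord; apply: eq_bigr => i _; rewrite perm1.
move=> s s1; pose f k : nat := if insub k is Some i then s i else 0.
have fE (i : 'I_d) : f i = s i by rewrite /f valK.
have fd k : (k < d)%N -> (f k < d)%N.
  by move=> kd; rewrite -[k]/(val (Ordinal kd)) fE.
rewrite (_ : \prod_(i < d) _ = \prod_(0 <= k < d) y (f k)); last first.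
  by rewrite big_mkord; apply: eq_bigr => i _; rewrite fE.
(* At such a [k] the adjacent factors [x (f k).+1] and [x (f k.+1)] have different indices, so their
   product is [0]. *)
suff [k [kd fk]] : exists k, (k.+1 < d)%N /\ f k.+1 <> (f k).+1.
  rewrite (big_cat_nat (n := k)) ?leq0n //=; last exact: ltnW (ltnW kd).
  rewrite (big_ltn (m := k)) ?(ltnW kd) // (big_ltn (m := k.+1)) //.
  have -> : y (f k) * (y (f k.+1) * \prod_(k.+2 <= i < d) y (f i)) = 0.
    have -> : y (f k) * (y (f k.+1) * \prod_(k.+2 <= i < d) y (f i)) =
       x (f k) * a (f k) * (x (f k).+1 * x (f k.+1)) * a (f k.+1) *
       x (f k.+1).+1 * \prod_(k.+2 <= i < d) y (f i) by rewrite /y !mulrA.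
    rewrite xx ?mulr0 ?mul0r //; first by rewrite fd // ltnW.
    by rewrite ltnW // fd.
    by move=> h; apply: fk.
  by rewrite !mulr0.
apply: contrapT => /forallNP h; move/eqP: s1; apply.
have fS k : (k.+1 < d)%N -> f k.+1 = (f k).+1.
  by move=> kd; apply: contrapT => fk; apply: (h k).
have fk k : (k < d)%N -> f k = (f 0 + k)%N.
  by elim: k => [|k IH] kd; [rewrite addn0 | rewrite fS // IH ?addnS // ltnW].
apply/permP => i; rewrite perm1; apply: val_inj => /=; rewrite -fE fk //.
(* At [k = d - 1] the formula [f k = f 0 + k < d] forces [f 0 = 0], so the permutation would be the
   identity. *)
have d0 : (d.-1 < d)%N by rewrite prednK // (leq_ltn_trans _ (ltn_ord i)).
have := fd _ d0; rewrite (fk _ d0); have := ltn_ord i.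
lia.
Qed.

End StandardPolynomial.

Section StandardIdentity.
Variables (C : numFieldType) (r : nat).

(** Expanding multilinearly in the [r * r] matrix units leaves only terms in which two of the [d]
    arguments coincide. *)
Lemma standard_poly_matrix d (a : 'I_d -> 'M[C]_r) : (r * r < d)%N ->
  standard_poly a = 0.
Proof.
move=> rd; pose E (p : 'I_r * 'I_r) : 'M[C]_r := delta_mx p.1 p.2.
pose c i (p : 'I_r * 'I_r) := a i p.1 p.2.
have aE i : a i = \sum_p c i p *: E p.
  by rewrite {1}[a i]matrix_sum_delta pair_bigA.
have prodE (f : 'I_d -> C) (g : 'I_d -> 'M[C]_r) :
    \prod_i (f i *: g i) = (\prod_i f i) *: \prod_i g i.
  elim/big_rec3: _ => [|i u v w _ ->]; first by rewrite scale1r.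
  by rewrite -[RHS]scalerA [in LHS]/GRing.mul /= -scalemxAl -scalemxAr.
have scale_r u (M N : 'M[C]_r) : M * (u *: N) = u *: (M * N).
  exact/esym/scalemxAr.
have SE : standard_poly a = \sum_(h : {ffun 'I_d -> 'I_r * 'I_r})
    (\prod_i c i (h i)) *: standard_poly (E \o h).
  rewrite /standard_poly.
  under [RHS]eq_bigr do rewrite scaler_sumr.
  rewrite exchange_big; apply: eq_bigr => t _ /=.
  under eq_bigr do rewrite aE.
  rewrite bigA_distr_bigA /= mulr_sumr.
  (* Substituting [h o t] for [h] makes the scalar factor independent of the permutation [t]. *)
  pose act (h : {ffun 'I_d -> 'I_r * 'I_r}) := [ffun i => h (t i)].
  rewrite (reindex act) /=; last first.
    exists (fun h : {ffun _ -> _} => [ffun i => h ((t^-1)%g i)]) => h _.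
      by apply/ffunP => i; rewrite !ffunE permKV.
    by apply/ffunP => i; rewrite !ffunE permK.
  apply: eq_bigr => h _; rewrite prodE scale_r.
  have -> : \prod_i c (t i) (act h i) = \prod_i c i (h i).
    rewrite [RHS](reindex_inj (@perm_inj _ t)) /=.
    by apply: eq_bigr => i _; rewrite ffunE.
  congr (_ *: _); congr (_ * _); apply: eq_bigr => i _.
  by rewrite /= ffunE.
rewrite SE big1 // => h _.
have /injectivePn[k [l kl hkl]] : ~~ injectiveb h.
  apply/negP => /injectiveP/leq_card.
  by rewrite card_prod !card_ord leqNgt rd.
have : standard_poly (E \o h) = - standard_poly (E \o h).
  by apply: (standard_poly_alt kl); rewrite /= hkl.
move/eqP; rewrite -subr_eq0 opprK -mulr2n -scaler_nat scaler_eq0 pnatr_eq0 /=.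
by move=> /eqP ->; rewrite scaler0.
Qed.

End StandardIdentity.

(** * Polynomial functions and generic points *)

Section PolynomialFunctions.

(* Functions [n |-> sum_j c_j n^(k_j)], restricted to natural [n] so that
   additive maps preserve them, conjugate-linear ones included. *)
Definition polyfun (V : zmodType) (f : nat -> V) :=
  exists s : seq (nat * V), forall n, f n = \sum_(p <- s) p.2 *+ n ^ p.1.

Lemma polyfunD (V : zmodType) (f g : nat -> V) :
  polyfun f -> polyfun g -> polyfun (fun n => f n + g n).
Proof. by move=> [s fs] [t gt]; exists (s ++ t) => n; rewrite big_cat fs gt. Qed.

Lemma polyfunN (V : zmodType) (f : nat -> V) :
  polyfun f -> polyfun (fun n => - f n).
Proof.
move=> [s fs]; exists [seq (p.1, - p.2) | p <- s] => n.
by rewrite fs big_map -sumrN; apply: eq_bigr => p _; rewrite mulNrn.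
Qed.

Lemma polyfun_affine (V : zmodType) (x y : V) : polyfun (fun n => x + y *+ n).
Proof.
exists [:: (0%N, x); (1%N, y)] => n.
by rewrite !big_cons big_nil /= expn0 expn1 addr0.
Qed.

Lemma morph_mulrn (U V : zmodType) (L : U -> V) : {morph L : x y / x + y} ->
  forall x n, L (x *+ n) = L x *+ n.
Proof.
move=> LD x; have L0 : L 0 = 0 by apply: (addrI (L 0)); rewrite -LD !addr0.
by elim=> [|n IH]; rewrite ?mulr0n // !mulrS LD IH.
Qed.

Lemma morph_sum (U V : zmodType) (L : U -> V) : {morph L : x y / x + y} ->
  forall I (r : seq I) (f : I -> U),
  L (\sum_(i <- r) f i) = \sum_(i <- r) L (f i).
Proof.
move=> LD I r f; have L0 : L 0 = 0 by apply: (addrI (L 0)); rewrite -LD !addr0.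
exact: (big_morph L LD L0).
Qed.

Lemma polyfun_additive (U V : zmodType) (L : U -> V) (f : nat -> U) :
  {morph L : x y / x + y} -> polyfun f -> polyfun (fun n => L (f n)).
Proof.
move=> LD [s fs]; exists [seq (p.1, L p.2) | p <- s] => n.
rewrite fs big_map (morph_sum LD).
by apply: eq_bigr => p _; rewrite (morph_mulrn LD).
Qed.

Lemma polyfun_biadditive (U V W : zmodType) (B : U -> V -> W)
    (f : nat -> U) (g : nat -> V) :
  (forall x, {morph B x : y z / y + z}) ->
  (forall y, {morph B^~ y : x z / x + z}) ->
  polyfun f -> polyfun g -> polyfun (fun n => B (f n) (g n)).
Proof.
move=> Br Bl [s fs] [t gt].
exists [seq ((p.1 + q.1)%N, B p.2 q.2) | p <- s, q <- t] => n.
rewrite fs gt (morph_sum (Bl _)) big_allpairs_dep; apply: eq_bigr => p _.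
rewrite (morph_sum (Br _)); apply: eq_bigr => q _ /=.
by rewrite (morph_mulrn (Bl _)) (morph_mulrn (Br _)) -mulrnA mulnC expnD.
Qed.

(** With arbitrarily large zeros there are as many distinct zeros as coefficients. The inverse of
    their Vandermonde matrix expresses each coefficient through values of [f] at zeros, so [f] would
    vanish identically. *)
Lemma polyfun_zeros (K : numFieldType) (V : lmodType K) (f : nat -> V) m :
  polyfun f -> f m != 0 -> exists N, forall n, (N <= n)%N -> f n != 0.
Proof.
move=> [s fs] fm; apply: contrapT => /forallNP h.
have zero N : exists2 n, (N <= n)%N & f n = 0.
  apply: contrapT => hN; apply: (h N) => n Nn; apply/eqP => fn.
  by apply: hN; exists n.
pose d := (\max_(p <- s) p.1).+1.
pose c (i : 'I_d) : V := \sum_(p <- s | p.1 == i) p.2.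
have fE n : f n = \sum_(i < d) (n%:R : K) ^+ i *: c i.
  rewrite fs (eq_big_seq (fun p : nat * V => \sum_(i < d | p.1 == i) p.2 *+ n ^ i)).
    rewrite (exchange_big_dep xpredT) //=; apply: eq_bigr => i _.
    rewrite scaler_sumr; apply: eq_bigr => p _.
    by rewrite -natrX scaler_nat.
  move=> p ps /=; have pd : (p.1 < d)%N by rewrite ltnS; exact: leq_bigmax_seq.
  by rewrite (big_pred1 (Ordinal pd)).
have [a aI af] : exists2 a : nat -> nat,
    {homo a : i j / (i < j)%N} & forall j, f (a j) = 0.
  have [g hg] := choice (fun N => let: ex_intro2 n Nn fn := zero N in ex_intro
    (fun n => (N <= n)%N /\ f n = 0) n (conj Nn fn)).
  pose a := fix a j := if j is i.+1 then g (a i).+1 else g 0%N.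
  exists a; last by case=> [|j]; case: (hg 0%N) => //; case: (hg (a j).+1).
  by apply: homo_ltn => [? ? ?|j]; [exact: ltn_trans | case: (hg (a j).+1)].
have a_inj : injective a.
  move=> i j; case: (ltngtP i j) => // /aI + eqa; rewrite eqa ltnn //.
pose A : 'M[K]_d := Vandermonde d (\row_j (a j)%:R).
have Au : A \in unitmx.
  rewrite unitmxE unitfE det_Vandermonde; apply/prodf_neq0 => i _.
  apply/prodf_neq0 => j ij; rewrite !mxE subr_eq0 eqr_nat.
  by apply: contraTneq ij => /a_inj ->; rewrite ltnn.
have c0 i : c i = 0.
  transitivity (\sum_k (A *m invmx A) k i *: c k).
    rewrite mulmxV // (bigD1 i) //= big1 ?addr0 ?mxE ?eqxx ?scale1r //.
    by move=> k ki; rewrite mxE (negbTE ki) scale0r.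
  under eq_bigr do rewrite mxE scaler_suml.
  rewrite exchange_big big1 //= => j _.
  transitivity (invmx A j i *: \sum_k A k j *: c k).
    by rewrite scaler_sumr; apply: eq_bigr => k _; rewrite scalerA mulrC.
  have -> : \sum_k A k j *: c k = f (a j).
    by rewrite fE; apply: eq_bigr => k _; rewrite !mxE.
  by rewrite af scaler0.
by move: fm; rewrite fE big1 ?eqxx // => i _; rewrite c0 scaler0.
Qed.

(* On the line through a point where the first functions do not vanish and a
   point where the last one does not, each has finitely many zeros. *)
Lemma generic_point (K : numFieldType) (V : lmodType K) (X : Type)
    (line : X -> X -> nat -> X) (J : eqType) (f : J -> X -> V) (js : seq J) :
  inhabited X ->
  (forall x y, line x y 0 = x /\ line x y 1 = y) ->
  (forall j x y, polyfun (fun n => f j (line x y n))) ->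
  (forall j, j \in js -> exists x, f j x != 0) ->
  exists x, forall j, j \in js -> f j x != 0.
Proof.
move=> [x0] lineE pf; elim: js => [|j js IH] h; first by exists x0.
have [x hx] : exists x, forall j, j \in js -> f j x != 0.
  by apply: IH => i ijs; apply: h; rewrite inE ijs orbT.
have [y hy] := h j (mem_head _ _).
have [lx ly] := lineE x y.
have [N hN] : exists N, forall n, (N <= n)%N ->
    forall i, i \in js -> f i (line x y n) != 0.
  elim: js {IH h} hx => [|i js IH] hx; first by exists 0%N.
  have [|N hN] := IH; first by move=> k ks; apply: hx; rewrite inE ks orbT.
  have [M hM] := polyfun_zeros (m := 0%N) (pf i x y)
    (eq_ind_r (fun z => f i z != 0) (hx i (mem_head _ _)) lx).
  exists (maxn M N) => n; rewrite geq_max => /andP[Mn Nn] k.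
  by rewrite inE => /orP[/eqP->|]; [exact: hM | exact: hN].
have [M hM] := polyfun_zeros (m := 1%N) (pf j x y)
  (eq_ind_r (fun z => f j z != 0) hy ly).
exists (line x y (maxn M N)) => i.
rewrite inE => /orP[/eqP->|]; first by apply: hM; exact: leq_maxl.
by apply: hN; exact: leq_maxr.
Qed.

End PolynomialFunctions.

(** * Simple algebras are prime *)

Section Simple.
Variables (R : realType) (A : cstarAlgebra R).

Lemma mul_le_eps (e n d : R) : 0 < e -> 0 <= n -> 0 <= d ->
  d <= e / (n + 1) -> n * d <= e.
Proof.
move=> e0 n0 d0; rewrite ler_pdivlMr; last lra.
nra.
Qed.

Lemma nrm_closed (J : set A) :
  (forall z, (forall e, 0 < e -> exists2 y, J y & nrm (z - y) <= e) -> J z) ->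
  closed J.
Proof.
move=> h z cl; apply: h => e e0.
have eC : 0 < e%:C :> R[i] by rewrite ltcR.
have [y [Jy]] := cl _ (nbhsx_ballx z _ eC).
rewrite -ball_normE /= nrmE ltcR => /ltW zy.
by exists y.
Qed.

(** The [z] with [x A z = 0] form a closed ideal. If it contained [y] it would be all of [A], yet
    [1] is not in it. *)
Lemma simple_prime (x y : A) : simple A -> x <> 0 -> y <> 0 ->
  exists a, x * a * y <> 0.
Proof.
move=> [_ sA] x0 y0; apply: contrapT => /forallNP h.
pose J : set A := [set z | forall a, x * a * z = 0].
have Jy : J y by move=> a; apply: contrapT; exact: h.
have : J = [set 0] \/ J = [set: A].
  apply: sA => //.
  - apply: nrm_closed => z hz a; apply: nrm_lim0 => e e0.
    have na := nrm_ge0 (x * a).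
    have f0 : 0 < e / (nrm (x * a) + 1) by apply: divr_gt0 => //; apply: ltr_wpDl.
    have [w Jw zw] := hz _ f0.
    have -> : x * a * z = x * a * (z - w) by rewrite mulrBr Jw subr0.
    apply: le_trans (nrmM _ _) _.
    exact: mul_le_eps (nrm_ge0 _) zw.
  - by move=> a; rewrite mulr0.
  - by move=> u v Ju Jv a; rewrite mulrDr Ju Jv addr0.
  - by move=> c u Ju a; rewrite -scaleAr Ju scaler0.
  - move=> b u Ju; split=> a; first by rewrite mulrA -(mulrA x) Ju.
    by rewrite mulrA Ju mul0r.
case=> JE; first by apply: y0; move: Jy; rewrite JE.
have : J 1 by rewrite JE.
by move=> /(_ 1); rewrite !mulr1.
Qed.

Lemma simple_standard_poly d (x : 'I_d.+1 -> A) : simple A -> orth_family x ->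
  exists a : 'I_d -> A, standard_poly a <> 0.
Proof.
move=> sA [sx x0 xx].
pose X k := x (inord k).
have XX i j : (i <= d)%N -> (j <= d)%N -> i <> j -> X i * X j = 0.
  move=> id jd ij; apply: xx; apply/eqP => h; apply: ij.
  by rewrite -(inordK (id : i < d.+1)%N) h inordK.
have X0 k : X k <> 0 by exact: x0.
have [a ha] : exists a : nat -> A,
    \prod_(0 <= k < d) (X k * a k * X k.+1) * X d <> 0.
  elim: (d) => [|m [a ha]].
    by exists (fun=> 0); rewrite big_geq // mul1r.
  (* One copy of [X m.+1] closes the new factor, the other becomes the trailing factor of the
     statement for [m.+1]. *)
  have XX0 : X m.+1 * X m.+1 <> 0 by move/(sqr_eq0 (sx _)); exact: X0.
  have [b hb] := simple_prime sA ha XX0.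
  exists (fun k => if k == m then b else a k).
  rewrite big_nat_recr //= eqxx (eq_big_nat _ _ (F2 := fun k => X k * a k * X k.+1)).
    by move: hb; rewrite !mulrA.
  by move=> k /andP[_ km]; rewrite ltn_eqF.
exists (fun i : 'I_d => X i * a i * X i.+1).
rewrite standard_poly_chain // => h; apply: ha.
by rewrite h mul0r.
Qed.

End Simple.

(** * Rank-one projections in matrix algebras *)

Section RankOne.
Variables (R : realType) (r : nat).
Implicit Types (u v w x y z : 'cV[R[i]]_r) (M P : 'M[R[i]]_r).

Definition dotc u v : R[i] := \sum_k (u k 0)^*%C * v k 0.

Definition outer u v : 'M[R[i]]_r := \matrix_(k, l) (u k 0 * (v l 0)^*%C).

Definition rank1 u : 'M[R[i]]_r := (dotc u u)^-1 *: outer u u.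

Lemma dotcDr u : {morph dotc u : v w / v + w}.
Proof.
by move=> v w; rewrite -big_split; apply: eq_bigr => k _; rewrite !mxE mulrDr.
Qed.

Lemma dotcDl v : {morph dotc^~ v : u w / u + w}.
Proof.
move=> u w; rewrite -big_split; apply: eq_bigr => k _.
by rewrite !mxE rmorphD mulrDl.
Qed.

Lemma dotcZr u v c : dotc u (c *: v) = c * dotc u v.
Proof. by rewrite mulr_sumr; apply: eq_bigr => k _; rewrite !mxE mulrCA. Qed.

Lemma dotcNr u v : dotc u (- v) = - dotc u v.
Proof. by rewrite -scaleN1r dotcZr mulN1r. Qed.

Lemma conj_dotc u v : (dotc u v)^*%C = dotc v u.
Proof.
rewrite rmorph_sum; apply: eq_bigr => k _.
by rewrite rmorphM /= conjcK mulrC.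
Qed.

Lemma dotc_sym0 u v : dotc u v = 0 -> dotc v u = 0.
Proof. by move=> h; rewrite -conj_dotc h rmorph0. Qed.

Lemma dotc_eq0 u : dotc u u = 0 -> u = 0.
Proof.
have sq (c : R[i]) : 0 <= c^*%C * c by rewrite mulrC; exact: mul_conjC_ge0.
move=> /eqP; rewrite psumr_eq0 // => /allP h.
apply/matrixP => k j; rewrite ord1 mxE; have := h k (mem_index_enum _).
by rewrite /= mulf_eq0 conjc_eq0 orbb => /eqP.
Qed.

Lemma outerDr u : {morph outer u : v w / v + w}.
Proof. by move=> v w; apply/matrixP => k l; rewrite !mxE rmorphD mulrDr. Qed.

Lemma outerDl v : {morph outer^~ v : u w / u + w}.
Proof. by move=> u w; apply/matrixP => k l; rewrite !mxE mulrDl. Qed.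

Lemma outerM u v w z : outer u v * outer w z = dotc v w *: outer u z.
Proof.
apply/matrixP => k l; rewrite !mxE mulr_suml; apply: eq_bigr => m _.
by rewrite !mxE; ring.
Qed.

Lemma mul_outer M u v : M * outer u v = outer (M *m u) v.
Proof.
apply/matrixP => k l; rewrite !mxE mulr_suml; apply: eq_bigr => m _.
by rewrite !mxE mulrA.
Qed.

Lemma mx_scale_r (c : R[i]) M P : M * (c *: P) = c *: (M * P).
Proof. exact/esym/scalemxAr. Qed.

Lemma mx_scale_l (c : R[i]) M P : (c *: M) * P = c *: (M * P).
Proof. exact/esym/scalemxAl. Qed.

Lemma rank1_projection u : u <> 0 -> projection (rank1 u).
Proof.
move=> u0; have d0 : dotc u u != 0 by apply/eqP => /dotc_eq0.
split.
  rewrite /rank1 [LHS]/star /=; apply/matrixP => k l; rewrite !mxE.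
  by rewrite !rmorphM fmorphV /= conj_dotc conjcK; ring.
by rewrite mx_scale_l mx_scale_r outerM !scalerA -mulrA mulVf // mulr1.
Qed.

Lemma rank1_mul u : u <> 0 -> rank1 u *m u = u.
Proof.
move=> u0; have d0 : dotc u u != 0 by apply/eqP => /dotc_eq0.
rewrite -scalemxAl (_ : outer u u *m u = dotc u u *: u).
  by rewrite scalerA mulVf // scale1r.
apply/matrixP => k j; rewrite ord1 !mxE mulr_suml; apply: eq_bigr => l _.
by rewrite !mxE; ring.
Qed.

Lemma dotc_mull M u v : dotc (M *m u) v = dotc u (star M *m v).
Proof.
transitivity (\sum_k \sum_l (M k l)^*%C * (u l 0)^*%C * v k 0).
  apply: eq_bigr => k _; rewrite !mxE rmorph_sum mulr_suml.
  by apply: eq_bigr => l _; rewrite rmorphM.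
rewrite exchange_big; apply: eq_bigr => l _; rewrite !mxE mulr_sumr.
by apply: eq_bigr => k _; rewrite !mxE; ring.
Qed.

Lemma rank1_neq0 u : u <> 0 -> rank1 u <> 0.
Proof.
by move=> u0 /(congr1 (mulmx^~ u)); rewrite mul0mx rank1_mul.
Qed.

(** A projection [M] below [rank1 u] equals its own compression, which is a multiple [c] of
    [rank1 u]; [M * M = M] forces [c * c = c]. *)
Lemma rank1_minimal u : u <> 0 -> minimal_projection (rank1 u).
Proof.
move=> u0; split; [exact: rank1_projection | exact: rank1_neq0 |].
move=> M [sM MM] PM.
have [sP PP] := rank1_projection u0.
have MP : M * rank1 u = M by rewrite -{1}sM -sP -starM PM sM.
have [c Mc] : exists c, M = c *: rank1 u.
  exists ((dotc u u)^-1 * dotc u (M *m u)).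
  rewrite -[LHS]PM -[in LHS]MP /rank1 mx_scale_l !mx_scale_r mul_outer outerM.
  by rewrite !scalerA; congr (_ *: _); ring.
have /eqP : c *: rank1 u - (c * c) *: rank1 u = 0.
  apply/eqP; rewrite subr_eq0 eq_sym; apply/eqP.
  by rewrite -scalerA -[in LHS]PP -mx_scale_r -mx_scale_l -Mc MM.
rewrite -scalerBl scaler_eq0 orbC; case/orP => [/eqP/(rank1_neq0 u0) //|].
rewrite -{1}[c]mulr1 -mulrBr mulf_eq0 subr_eq0 => /orP[/eqP c0|/eqP c1].
  by left; rewrite Mc c0 scale0r.
by right; rewrite Mc -c1 scale1r.
Qed.

(** A nonzero column [u] of [M] is fixed by [M], so [rank1 u] lies below [M]. *)
Lemma minimal_rank1 M : minimal_projection M -> exists2 u, u <> 0 & M = rank1 u.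
Proof.
move=> [[sM MM] M0 Mmin].
have [l ul] : exists l, col l M <> 0.
  apply: contrapT => /forallNP h; apply: M0; apply/matrixP => k l.
  by have /contrapT/matrixP/(_ k 0) := h l; rewrite !mxE.
have Mu : M *m col l M = col l M by rewrite !colE mulmxA -[M *m M]/(M * M) MM.
exists (col l M) => //.
case: (Mmin _ (rank1_projection ul)) => [|/rank1_neq0|->] //.
by rewrite mx_scale_r mul_outer Mu.
Qed.

Lemma rank1M_eq0 u v : dotc u v = 0 -> rank1 u * rank1 v = 0.
Proof. by move=> uv; rewrite mx_scale_l mx_scale_r outerM uv scale0r !scaler0. Qed.

Lemma dotc_rank1 u v : u <> 0 -> v <> 0 -> rank1 u * rank1 v = 0 -> dotc u v = 0.
Proof.
move=> u0 v0 uv; have [su _] := rank1_projection u0.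
rewrite -{1}(rank1_mul u0) -(rank1_mul v0) dotc_mull su mulmxA.
rewrite -[rank1 u *m _]/(rank1 u * rank1 v) uv mul0mx.
by rewrite -(scale0r 0) dotcZr mul0r.
Qed.

End RankOne.

(** * Orthogonal frames and strict order *)

Section GramSchmidt.
Variables (R : realType) (r : nat).
Implicit Types (u v w : 'cV[R[i]]_r) (V W : nat -> 'cV[R[i]]_r) (js : seq nat).

Definition reject u v := dotc u u *: v - dotc u v *: u.

(* Gram-Schmidt without division, so that the result is polynomial in the
   input. *)
Fixpoint gram_schmidt_seq V k := if k is l.+1 then
  rcons (gram_schmidt_seq V l) (foldr reject (V l) (gram_schmidt_seq V l))
  else [::].

Definition gram_schmidt V k := foldr reject (V k) (gram_schmidt_seq V k).

Lemma gram_schmidt_seqE V k : gram_schmidt_seq V k = map (gram_schmidt V) (iota 0 k).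
Proof.
by elim: k => // k IH; rewrite -[k.+1]addn1 iotaD map_cat -IH cats1 addn1.
Qed.

Lemma gram_schmidtE V k :
  gram_schmidt V k = foldr reject (V k) (map (gram_schmidt V) (iota 0 k)).
Proof. by rewrite -gram_schmidt_seqE. Qed.

Lemma dotc_reject u w v : dotc u (reject w v) = dotc w w * dotc u v - dotc w v * dotc u w.
Proof. by rewrite dotcDr dotcNr !dotcZr. Qed.

Lemma foldr_reject_orth W v js : uniq js ->
  {in js &, forall a b, a != b -> dotc (W a) (W b) = 0} ->
  {in js, forall a, dotc (W a) (foldr reject v (map W js)) = 0}.
Proof.
elim: js => //= j js IH /andP[jjs ujs] Wo a.
have {}IH : {in js, forall a, dotc (W a) (foldr reject v (map W js)) = 0}.
  apply: IH => // b c bjs cjs; apply: Wo; rewrite inE ?bjs ?cjs ?orbT //.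
rewrite inE dotc_reject => /orP[/eqP->|ajs]; first by rewrite mulrC subrr.
have aj : a != j by apply: contraNneq jjs => <-.
have ajj : a \in j :: js by rewrite inE ajs orbT.
by rewrite IH // (Wo _ _ ajj (mem_head _ _) aj) !mulr0 subr0.
Qed.

Lemma gram_schmidt_orth V j k : j != k ->
  dotc (gram_schmidt V j) (gram_schmidt V k) = 0.
Proof.
suff lt m : forall j k, (j < k)%N -> (k < m)%N ->
    dotc (gram_schmidt V j) (gram_schmidt V k) = 0.
  rewrite neq_ltn => /orP[|] h; first exact: lt h (ltnSn _).
  exact/dotc_sym0/(lt _ _ _ h (ltnSn _)).
elim: m => // m IH a b ab bm; rewrite [X in dotc _ X]gram_schmidtE.
apply: foldr_reject_orth; rewrite ?iota_uniq ?mem_iota // => c d.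
rewrite !mem_iota !add0n /= => cb db.
rewrite neq_ltn => /orP[|] h; first by apply: IH => //; exact: leq_trans db bm.
by apply/dotc_sym0/IH => //; exact: leq_trans cb bm.
Qed.

(** On orthogonal vectors the process only rescales, so the polynomial parametrization reaches every
    orthogonal frame up to nonzero scalars. *)
Lemma gram_schmidt_id V m : (forall j, (j < m)%N -> V j <> 0) ->
  (forall j k, (j < m)%N -> (k < m)%N -> j != k -> dotc (V j) (V k) = 0) ->
  forall k, (k < m)%N -> exists2 c, c != 0 & gram_schmidt V k = c *: V k.
Proof.
move=> V0 Vo k; elim/ltn_ind: k => k IH km; rewrite gram_schmidtE.
have : all (fun j => j < k)%N (iota 0 k).
  by apply/allP => j; rewrite mem_iota.
elim: (iota 0 k) => [|j js IHj] /=; first by exists 1; rewrite ?oner_eq0 ?scale1r.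
move=> /andP[jk /IHj[c c0 ->]].
have jm := ltn_trans jk km.
have [d d0 ->] := IH j jk jm.
have dV : dotc (d *: V j) (c *: V k) = 0.
  rewrite dotcZr; apply/eqP; rewrite mulf_eq0; apply/orP; right; apply/eqP.
  by apply: dotc_sym0; rewrite dotcZr Vo ?mulr0 // gtn_eqF.
exists (dotc (d *: V j) (d *: V j) * c).
  rewrite mulf_neq0 //; apply/eqP => /dotc_eq0/eqP.
  by rewrite scaler_eq0 (negbTE d0) => /eqP; exact: V0.
by rewrite /reject dV scale0r subr0 scalerA.
Qed.

Lemma polyfun_dotc (f g : nat -> 'cV[R[i]]_r) :
  polyfun f -> polyfun g -> polyfun (fun n => dotc (f n) (g n)).
Proof. by apply: polyfun_biadditive => x; [exact: dotcDr | exact: dotcDl]. Qed.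

Lemma polyfun_reject (f g : nat -> 'cV[R[i]]_r) :
  polyfun f -> polyfun g -> polyfun (fun n => reject (f n) (g n)).
Proof.
have pZ (c : nat -> R[i]) (h : nat -> 'cV[R[i]]_r) :
    polyfun c -> polyfun h -> polyfun (fun n => c n *: h n).
  apply: polyfun_biadditive => [x y z|y x z]; first exact: scalerDr.
  exact: scalerDl.
move=> pf pg; apply: polyfunD; first by apply: pZ => //; exact: polyfun_dotc.
by apply: polyfunN; apply: pZ => //; exact: polyfun_dotc.
Qed.

Lemma polyfun_gram_schmidt (V : nat -> nat -> 'cV[R[i]]_r) :
  (forall k, polyfun (V^~ k)) -> forall k, polyfun (fun n => gram_schmidt (V n) k).
Proof.
move=> pV k; elim/ltn_ind: k => k IH.
have {}IH : forall j, j \in iota 0 k -> polyfun (fun n => gram_schmidt (V n) j).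
  by move=> j; rewrite mem_iota => /= jk; exact: IH.
suff [s hs] : polyfun (fun n =>
    foldr reject (V n k) (map (gram_schmidt (V n)) (iota 0 k))).
  by exists s => n; rewrite gram_schmidtE hs.
elim: (iota 0 k) IH => [|j js IHj] IH; first exact: pV.
apply: polyfun_reject; first by apply: IH; exact: mem_head.
by apply: IHj => i ijs; apply: IH; rewrite inE ijs orbT.
Qed.

(** Fewer than [r] vectors leave a nonzero vector orthogonal to all of them. The case [k = 2]
    completes an orthogonal pair to a frame. *)
Lemma orth_extension V k m : (k <= m <= r)%N ->
  (forall i, (i < k)%N -> V i <> 0) ->
  (forall i j, (i < k)%N -> (j < k)%N -> i != j -> dotc (V i) (V j) = 0) ->
  exists W, [/\ forall i, (i < k)%N -> W i = V i,
    forall i, (i < m)%N -> W i <> 0 &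
    forall i j, (i < m)%N -> (j < m)%N -> i != j -> dotc (W i) (W j) = 0].
Proof.
move=> /andP[km mr] V0 Vo.
elim: m km mr => [|m IH] km mr.
  by exists V; split.
move: km; rewrite leq_eqVlt => /orP[/eqP <-|]; first by exists V; split.
rewrite ltnS => km; have [W [WV W0 Wo]] := IH km (ltnW mr).
pose M : 'M[R[i]]_(m, r) := \matrix_(i, l) (W i l 0)^*%C.
have : kermx M^T != 0.
  rewrite kermx_eq0 /row_free mxrank_tr; apply/negP => /eqP h.
  by have := rank_leq_row M; rewrite h leqNgt mr.
move=> /rowV0Pn[v /sub_kermxP vM v0].
have vW i : (i < m)%N -> dotc (W i) v^T = 0.
  move=> im; have := congr1 (fun N : 'rV[R[i]]_m => N 0 (Ordinal im)) vM.
  rewrite !mxE => <-; apply: eq_bigr => l _; rewrite !mxE mulrC //.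
exists (fun i => if i == m then v^T else W i); split.
- by move=> i ik; rewrite ltn_eqF ?WV // (leq_trans ik).
- move=> i; rewrite ltnS leq_eqVlt => /orP[->|im].
    by move=> /(congr1 trmx); rewrite trmxK trmx0; exact/eqP.
  by rewrite ltn_eqF //; exact: W0.
- move=> i j; rewrite !ltnS [(i <= m)%N]leq_eqVlt [(j <= m)%N]leq_eqVlt.
  case: (eqVneq i m) => [->|im] /=; case: (eqVneq j m) => [->|jm] //=.
  + by move=> _ hj _; apply: dotc_sym0; exact: vW.
  + by move=> hi _ _; exact: vW.
  + by move=> hi hj; exact: Wo.
Qed.

End GramSchmidt.

Section OrderZero.
Variables (R : realType) (A : cstarAlgebra R).

Lemma polyfun_outer_mul p q (f : 'M[R[i]]_p -> A) (g : 'M[R[i]]_q -> A) u v :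
  {morph f : x y / x + y} -> {morph g : x y / x + y} ->
  polyfun u -> polyfun v ->
  polyfun (fun n => f (outer (u n) (u n)) * g (outer (v n) (v n))).
Proof.
move=> fD gD pu pv.
have po m (w : nat -> 'cV[R[i]]_m) : polyfun w -> polyfun (fun n => outer (w n) (w n)).
  by move=> pw; apply: polyfun_biadditive => // x; [exact: outerDr | exact: outerDl].
apply: polyfun_biadditive => [x y z|y x z||].
- exact: mulrDr.
- exact: mulrDl.
- by apply: polyfun_additive => //; exact: po.
- by apply: polyfun_additive => //; exact: po.
Qed.

Lemma outerZ r (c : R[i]) (u : 'cV[R[i]]_r) :
  outer (c *: u) (c *: u) = (c * c^*%C) *: outer u u.
Proof. by apply/matrixP => k l; rewrite !mxE rmorphM /=; ring. Qed.

Lemma ord_other n (i : 'I_n.+2) : exists j, i != j.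
Proof.
by have [->|i0] := eqVneq i ord0; [exists ord_max | exists ord0].
Qed.

Lemma outer_neq0 r (f : 'M[R[i]]_r -> A) u : {morph f : x y / x + y} ->
  f (outer u u) <> 0 -> u <> 0.
Proof.
move=> fD h u0; apply: h; rewrite u0.
have -> : outer 0 0 = 0 :> 'M[R[i]]_r.
  by apply/matrixP => k l; rewrite !mxE mul0r.
by apply: (addrI (f 0)); rewrite -fD !addr0.
Qed.

(* The frames are parametrized polynomially by Gram-Schmidt, so the
   product vanishing for a pair of indices depending on the frame vanishes
   for a fixed pair and all frames. *)
Lemma order_zero_of_frames r n (f : 'M[R[i]]_r -> A) : {morph f : x y / x + y} ->
  (forall c x, f (c *: x) = c *: f x) -> (n.+2 <= r)%N ->
  (forall u : 'I_n.+2 -> 'cV[R[i]]_r, (forall i, u i <> 0) ->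
    (forall i j, i != j -> dotc (u i) (u j) = 0) ->
    exists i j, i != j /\ f (outer (u i) (u i)) * f (outer (u j) (u j)) = 0) ->
  forall x y, x <> 0 -> y <> 0 -> dotc x y = 0 ->
    f (outer x x) * f (outer y y) = 0.
Proof.
move=> fD fZ nr H x y x0 y0 xy; apply: contrapT => fxy.
pose T := ('I_n.+2 * 'I_n.+2)%type.
pose g V k := f (outer (gram_schmidt V k) (gram_schmidt V k)).
pose F (p : T) V := g V p.1 * g V p.2.
pose line (V W : nat -> 'cV[R[i]]_r) m k := V k + (W k - V k) *+ m.
(* If the product is nonzero for [x] and [y], then for each pair [k], [l] it is nonzero on a frame
   with multiples of [x] at [k] and of [y] at [l]. A generic frame then violates [H] for all pairs
   at once. *)
have [V hV] : exists V, forall p : T,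
    p \in [seq p <- enum {: T} | p.1 != p.2] -> F p V != 0.
  apply: (generic_point (line := line)).
  - by exists; exact: (fun=> 0).
  - move=> V W; split; apply: funext => k; first by rewrite /line mulr0n addr0.
    by rewrite /line mulr1n addrC subrK.
  - move=> p V W; have pg k : polyfun (fun m => gram_schmidt (line V W m) k).
      by apply: polyfun_gram_schmidt => j; exact: polyfun_affine.
    exact: polyfun_outer_mul.
  move=> [k l]; rewrite mem_filter /= => /andP[kl _].
  have [|||W [WV W0 Wo]] := @orth_extension _ r
    (fun i => if i == 0%N then x else y) 2 n.+2; first by rewrite nr.
  - by case=> [|[|]].
  - by move=> [|[|i]] [|[|j]] //= _ _ _; rewrite ?(dotc_sym0 xy).
  (* The permutation [t] below sends [k] to [0] and [l] to [1]; its second transposition corrects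
     where the first one sends [l]. *)
  pose l' := tperm ord0 k l.
  have l'0 : l' != ord0.
    apply: contra kl => /eqP h; apply/eqP.
    by apply: (@perm_inj _ (tperm ord0 k)); rewrite tpermR; exact/esym/h.
  have i1 : (1 < n.+2)%N by [].
  pose t := (tperm ord0 k * tperm (Ordinal i1) l')%g.
  have tk : t k = ord0.
    by rewrite permM tpermR tpermD // -val_eqE.
  have tl : t l = Ordinal i1 by rewrite permM -/l' tpermR.
  pose V j := W (t (inord j)).
  have VE (i : 'I_n.+2) : V i = W (t i) by rewrite /V inord_val.
  have V0 j : (j < n.+2)%N -> V j <> 0 by move=> _; apply: W0; exact: ltn_ord.
  have Vo i j : (i < n.+2)%N -> (j < n.+2)%N -> i != j -> dotc (V i) (V j) = 0.
    move=> hi hj ij; apply: Wo; try exact: ltn_ord.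
    apply: contra ij => /eqP/val_inj/perm_inj/(congr1 val).
    by rewrite /= !inordK // => ->.
  exists V; have [a a0 ga] := gram_schmidt_id V0 Vo (ltn_ord k).
  have [b b0 gb] := gram_schmidt_id V0 Vo (ltn_ord l).
  rewrite /F /g /= ga gb !VE tk tl !WV //= !outerZ !fZ -scaleAl -scaleAr.
  rewrite scalerA scaler_eq0 negb_or; apply/andP; split; last exact/eqP.
  by rewrite !mulf_neq0 ?conjc_eq0.
have FV i j : i != j -> F (i, j) V <> 0.
  by move=> ij; apply/eqP/hV; rewrite mem_filter /= ij mem_enum.
have [|i j ij|i [j [ij]]] := H (fun i => gram_schmidt V i).
- move=> i u0; have [j ij] := ord_other i; apply: (FV _ _ ij).
  have [/(outer_neq0 fD)|] := pselect (g V i <> 0); first by [].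
  by move=> /contrapT gi; rewrite /F /= gi mul0r.
- by apply: gram_schmidt_orth.
- exact: FV ij.
Qed.

(** Vectors in distinct blocks can be chosen independently, so generic vectors replace generic
    frames. A block unit is a sum of [outer] terms of basis vectors; hence if the product of two
    units has nonzero image, so has the product for some pair of basis vectors. *)
Lemma center_orth_of_vectors s (r : 'I_s -> nat) n (t : 'I_n.+2 -> 'I_s)
    (f : forall i, 'M[R[i]]_(r i) -> A) :
  (forall i, {morph f i : x y / x + y}) -> injective t ->
  (forall w : forall i, 'cV[R[i]]_(r i), (forall k, w (t k) <> 0) ->
    exists k l, k != l /\
      f _ (outer (w (t k)) (w (t k))) * f _ (outer (w (t l)) (w (t l))) = 0) ->
  exists k l, k != l /\ f (t k) 1 * f (t l) 1 = 0.
Proof.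
move=> fD tI H; apply: contrapT => noorth.
pose X := forall i, 'cV[R[i]]_(r i).
pose T := ('I_n.+2 * 'I_n.+2)%type.
pose g (w : X) k := f (t k) (outer (w (t k)) (w (t k))).
pose F (p : T) (w : X) := g w p.1 * g w p.2.
pose line (v w : X) m : X := fun k => v k + (w k - v k) *+ m.
have id_sum i : 1%:M = \sum_k outer (delta_mx k 0) (delta_mx k 0)
    :> 'M[R[i]]_(r i).
  apply/matrixP => a b; rewrite summxE (bigD1 a) //= big1 ?addr0.
    by rewrite !mxE !eqxx /= mul1r rmorph_nat andbT [b == a]eq_sym.
  by move=> k ka; rewrite !mxE eq_sym (negbTE ka) mul0r.
have [w hw] : exists w, forall p : T,
    p \in [seq p <- enum {: T} | p.1 != p.2] -> F p w != 0.
  apply: (generic_point (line := line)).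
  - by exists; exact: (fun=> 0).
  - move=> v w; split; apply: functional_extensionality_dep => k.
      by rewrite /line mulr0n addr0.
    by rewrite /line mulr1n addrC subrK.
  - move=> p v w; apply: polyfun_outer_mul; do ?exact: fD; exact: polyfun_affine.
  move=> [k l]; rewrite mem_filter /= => /andP[kl _].
  apply: contrapT => /forallNP h; apply: noorth; exists k, l; split => //.
  rewrite -[f (t k) 1]/(f (t k) 1%:M) -[f (t l) 1]/(f (t l) 1%:M) !id_sum.
  rewrite !(morph_sum (fD _)) mulr_suml big1 // => a _.
  rewrite mulr_sumr big1 // => b _.
  have kl' : t k != t l by rewrite (inj_eq tI).
  pose v : X := @eqtype.dfwith _ (fun j => 'cV[R[i]]_(r j)) (fun j => 0) (t k)
    (delta_mx a 0).
  pose w : X := @eqtype.dfwith _ (fun j => 'cV[R[i]]_(r j)) v (t l) (delta_mx b 0).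
  have wk : w (t k) = delta_mx a 0.
    by rewrite /w eqtype.dfwith_out 1?eq_sym // /v eqtype.dfwith_in.
  have wl : w (t l) = delta_mx b 0 by rewrite /w eqtype.dfwith_in.
  have /negP := h w.
  by rewrite negbK /F /g /= wk wl => /eqP.
have Fw k l : k != l -> F (k, l) w <> 0.
  by move=> kl; apply/eqP/hw; rewrite mem_filter /= kl mem_enum.
have [k wk|k [l [kl]]] := H w; last exact: Fw kl.
have [l kl] := ord_other k; apply: (Fw _ _ kl).
have [/(outer_neq0 (fD _))|] := pselect (g w k <> 0); first by [].
by move=> /contrapT gk; rewrite /F /= gk mul0r.
Qed.

End OrderZero.

(** * Minimal projections of direct sums and of [C^s] *)

Section DirectSumProjections.
Variables (R : realType) (F : cstarAlgebra R) (s : nat) (r : 'I_s -> nat).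
Variable Th : (forall i, 'M[R[i]]_(r i)) -> F.
Hypothesis iso : direct_sum_iso Th.

Let bl i M := @block R F s r Th i M.

Lemma mul_block i (M : 'M[R[i]]_(r i)) z : bl M * Th z = bl (M * z i).
Proof.
have [_ _ mul _] := iso.
rewrite -mul; congr Th; apply: functional_extensionality_dep => j.
by have [<-|ij] := eqVneq i j; rewrite ?summand_in // !summand_out // mul0r.
Qed.

Lemma block_mul i (M : 'M[R[i]]_(r i)) z : Th z * bl M = bl (z i * M).
Proof.
have [_ _ mul _] := iso.
rewrite -mul; congr Th; apply: functional_extensionality_dep => j.
by have [<-|ij] := eqVneq i j; rewrite ?summand_in // !summand_out // mulr0.
Qed.

Lemma block_projection i (M : 'M[R[i]]_(r i)) :
  projection (bl M) <-> projection M.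
Proof.
split=> -[sM MM]; split.
- by apply: (block_inj iso); rewrite (block_star iso).
- by apply: (block_inj iso); rewrite (blockM iso).
- by rewrite -(block_star iso) sM.
- by rewrite -(blockM iso) MM.
Qed.

Lemma block_minimal i (M : 'M[R[i]]_(r i)) :
  minimal_projection M -> minimal_projection (bl M).
Proof.
move=> [pM M0 Mmin]; split; first exact/block_projection.
  by rewrite -(block0 iso i) => /(block_inj iso).
move=> q pq Mq; have [[g _ gK] _ _ _] := iso.
have [N qE] : exists N : 'M[R[i]]_(r i), q = bl N.
  by exists (M * g q i); rewrite -mul_block gK Mq.
move: pq Mq; rewrite qE => /block_projection pN.
rewrite -(blockM iso) => /(block_inj iso) MN.
by case: (Mmin _ pN MN) => ->; [left; exact: (block0 iso) | right].
Qed.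

(** Some component of [e] is nonzero; placed in its block it is a nonzero projection below [e],
    hence equal to [e]. *)
Lemma minimal_block e : minimal_projection e ->
  exists i (M : 'M[R[i]]_(r i)), minimal_projection M /\ e = bl M.
Proof.
move=> [[se ee] e0 emin]; have [[g thK gK] _ mul st] := iso.
have [i zi] : exists i, g e i <> 0.
  apply: contrapT => /forallNP h; apply: e0.
  rewrite -[e]gK -(direct_sum0 iso); congr Th.
  by apply: functional_extensionality_dep => i; apply: contrapT; exact: h.
have proj : projection (g e i).
  split.
    have : g e = fun i => star (g e i) by rewrite -[RHS]thK st gK se.
    by move=> /(congr1 (fun f => f i)) <-.
  have : g e = fun i => g e i * g e i by rewrite -[RHS]thK mul gK ee.
  by move=> /(congr1 (fun f => f i)) <-.
have eM (N : 'M[R[i]]_(r i)) : e * bl N = bl (g e i * N).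
  by rewrite -block_mul gK.
have ebl : bl (g e i) = e.
  have [_ MM] := proj.
  case: (emin (bl (g e i))) => //; first exact/block_projection.
    by rewrite eM MM.
  by rewrite -(block0 iso i) => /(block_inj iso).
exists i, (g e i); split => //; split => // N pN MN.
have := emin (bl N); rewrite eM MN => /(_ (iffRL (block_projection _) pN) erefl).
case=> [bN|bN]; [left | right]; apply: (block_inj iso).
  by rewrite block0.
exact: etrans bN (esym ebl).
Qed.

Lemma center_pred1 i :
  Th (center_embedding r [ffun j => (j == i)%:R]) = bl (1 : 'M[R[i]]_(r i)).
Proof.
congr Th; apply: functional_extensionality_dep => j.
rewrite /center_embedding ffunE; have [->|ji] := eqVneq j i.
  by rewrite summand_in.
rewrite summand_out 1?eq_sym //; apply/matrixP => k l.
by rewrite !mxE mul0rn.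
Qed.

End DirectSumProjections.

Section MinimalProjections.

Lemma elementary_of_orth (F : starRingType) n (e : 'I_n -> F) :
  (forall i, minimal_projection (e i)) ->
  (forall i j, i != j -> e i * e j = 0) -> elementary e.
Proof.
move=> emin e0; split => // i j eij; apply/eqP; apply: contrapT => /negP/e0.
by rewrite -eij; have [[_ ->] + _] := emin i.
Qed.

Variables (R : realType) (s : nat).
Let delta (i : 'I_s) : {ffun 'I_s -> R[i]} := [ffun j => (j == i)%:R].

Lemma delta_projection i : projection (delta i).
Proof.
split; apply/ffunP => j; rewrite !ffunE.
  by case: eqP => _; rewrite ?rmorph1 ?rmorph0.
by case: eqP => _; rewrite ?mulr1 ?mulr0.
Qed.

Lemma delta_neq0 i : delta i <> 0.
Proof. by move=> /ffunP/(_ i)/eqP; rewrite !ffunE eqxx oner_eq0. Qed.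

Lemma delta_minimal i : minimal_projection (delta i).
Proof.
split; [exact: delta_projection | exact: delta_neq0 |].
move=> q [_ /ffunP/(_ i)] + /ffunP q0; rewrite ffunE => /eqP.
rewrite -subr_eq0 -{3}[q i]mulr1 -mulrBr mulf_eq0 subr_eq0.
case/orP => /eqP qi; [left | right]; apply/ffunP => j; rewrite -q0 !ffunE.
  by case: eqP => [->|_]; rewrite ?qi ?mulr0 ?mul0r.
by case: eqP => [->|_]; rewrite ?qi ?mulr1 ?mul0r.
Qed.

Lemma deltaM i j : i != j -> delta i * delta j = 0.
Proof.
move=> ij; apply/ffunP => k; rewrite !ffunE.
by case: eqP => [->|_]; rewrite ?mul0r // (negbTE ij) mulr0.
Qed.

Lemma minimal_delta (e : {ffun 'I_s -> R[i]}) : minimal_projection e ->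
  exists i, e = delta i.
Proof.
move=> [[_ ee] e0 emin].
have [i ei] : exists i, e i <> 0.
  apply: contrapT => /forallNP h; apply: e0; apply/ffunP => i.
  by rewrite ffunE; apply: contrapT; exact: h.
have ei1 : e i = 1.
  have /ffunP/(_ i) := ee; rewrite ffunE => eei; move/eqP: ei => ei.
  by apply: (mulfI ei); rewrite mulr1.
exists i; case: (emin _ (delta_projection i)) => [|/delta_neq0 //|-> //].
apply/ffunP => j; rewrite !ffunE.
by case: eqP => [->|_]; rewrite ?ei1 ?mulr1 ?mulr0.
Qed.

End MinimalProjections.

Lemma projection_pos (R : realType) (A : cstarAlgebra R) (p : A) :
  projection p -> pos p.
Proof. by move=> [sp pp]; rewrite -pp; exact: pos_sqr. Qed.

Lemma ord2_cases (i : 'I_2) : i = ord0 \/ i = ord_max.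
Proof. by case: i => [[|[|//]] hi]; [left | right]; exact: val_inj. Qed.

(** Two projections in one block are handled by order zero there. If all blocks are distinct, two
    block units have orthogonal images; each unit is [e k] plus a positive element, so the images of
    the two projections are orthogonal as well. *)
Lemma ph_ord_le_ord_le (R : realType) (F A : cstarAlgebra R)
    (phi : {linear F -> A}) n : cpc phi -> ph_ord_le phi n -> ord_le phi n.
Proof.
move=> cphi [s [r [Th [r0 iso oz oc]]]] e [einj emin eorth].
have cp := cphi.1.
have [t ht] := choice (fun k => minimal_block iso (emin k)).
have [tI|] := pselect (injective t); last first.
  move=> tN; have [k [l [kl tkl]]] : exists k l, k != l /\ t k = t l.
    apply: contrapT => h; apply: tN => k l tkl; apply: contrapT => /eqP kl.
    by apply: h; exists k, l.
  have [M [minM eM]] := ht k; have [N [minN eN]] := ht l.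
  move: N minN eN; rewrite -tkl => N minN eN.
  have MN : M * N = 0.
    by apply: (block_inj iso); rewrite (blockM iso) -eM -eN eorth // block0.
  have NM : N * M = 0.
    by apply: (block_inj iso); rewrite (blockM iso) -eM -eN eorth ?block0 // eq_sym.
  pose f (i : 'I_2) := if i == ord0 then M else N.
  have ef : elementary f.
    apply: elementary_of_orth => [i|i j]; rewrite /f.
      by case: eqP.
    by case: (ord2_cases i) => ->; case: (ord2_cases j) => ->.
  have [i [j [ij]]] := oz (t k) f ef; rewrite /f /=.
  case: (ord2_cases i) ij => ->; case: (ord2_cases j) => -> //= _ E.
    by exists k, l; rewrite eM eN.
  by exists l, k; rewrite eM eN eq_sym.
have phi_block k : exists2 N : F, pos N & block Th (1 : 'M[R[i]]_(r (t k))) = e k + N.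
  have [M [[pM _ _] eM]] := ht k.
  exists (block Th (1 - M)).
    apply/projection_pos/(block_projection iso).
    have [sM MM] := pM; split; first by rewrite starB star1 sM.
    by rewrite mulrBl mul1r mulrBr mulr1 MM subrr subr0.
  by rewrite eM -(blockD iso) addrC subrK.
have epos k : pos (e k) by apply: projection_pos; case: (emin k).
have [|k [l [kl]]] := oc (fun k => [ffun j => (j == t k)%:R]).
  apply: elementary_of_orth => [k|k l kl]; first exact: delta_minimal.
  by apply: deltaM; rewrite (inj_eq tI).
rewrite /= !center_pred1.
have [N pN ->] := phi_block k; have [N' pN' ->] := phi_block l.
rewrite !linearD => E; exists k, l; split => //.
have E1 := pos_addM_eq0 (cp_pos cp (epos k)) (cp_pos cp pN) E.
have E2 : (phi (e l) + phi N') * phi (e k) = 0.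
  rewrite -[LHS]starK starM (pos_sa (cp_pos cp (epos k))).
  by rewrite (pos_sa (posD (cp_pos cp (epos l)) (cp_pos cp pN'))) E1 star0.
have E3 := pos_addM_eq0 (cp_pos cp (epos l)) (cp_pos cp pN') E2.
rewrite -[LHS]starK starM (pos_sa (cp_pos cp (epos k))).
by rewrite (pos_sa (cp_pos cp (epos l))) E3 star0.
Qed.

(** * Small blocks *)

Section SmallBlocks.
Variables (R : realType) (F A : cstarAlgebra R) (n : nat).
Variables (phi : {linear F -> A}) (s : nat) (r : 'I_s -> nat).
Variable Th : (forall i, 'M[R[i]]_(r i)) -> F.
Hypothesis r0 : forall i, (0 < r i)%N.
Hypothesis iso : direct_sum_iso Th.
Hypothesis ordphi : ord_le phi n.

(** The threshold [n + 2] is the number of orthogonal vectors in the sets on which [ord_le phi n] is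
    tested. *)
Definition large_unit : F :=
  Th (fun i => if (n.+1 < r i)%N then 1 else 0).

Let f i (M : 'M[R[i]]_(r i)) : A := phi (block Th M).

Let fD i : {morph f (i := i) : x y / x + y}.
Proof. by move=> x y; rewrite /f (blockD iso) linearD. Qed.

Let fZ i c (M : 'M[R[i]]_(r i)) : f (c *: M) = c *: f M.
Proof. by rewrite /f (blockZ iso) linearZ. Qed.

Let outer_rank1 i (u : 'cV[R[i]]_(r i)) : u <> 0 ->
  exists2 c : R[i], c != 0 & outer u u = c *: rank1 u.
Proof.
move=> u0; have d0 : dotc u u != 0 by apply/eqP => /dotc_eq0.
by exists (dotc u u); rewrite // /rank1 scalerA mulfV // scale1r.
Qed.

(** The genericity argument needs the polynomial expression [outer u u], strict order the projection
    [rank1 u]; they differ by a nonzero scalar. *)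
Let f_outer_eq0 i j (u : 'cV[R[i]]_(r i)) (v : 'cV[R[i]]_(r j)) :
  u <> 0 -> v <> 0 ->
  f (outer u u) * f (outer v v) = 0 <-> f (rank1 u) * f (rank1 v) = 0.
Proof.
move=> /outer_rank1[c c0 ->] /outer_rank1[d d0 ->].
rewrite !fZ -scaleAl -scaleAr; split=> [|->]; last by rewrite !scaler0.
by move/eqP; rewrite !scaler_eq0 (negbTE c0) (negbTE d0) => /eqP.
Qed.

Lemma large_unit_block i (M : 'M[R[i]]_(r i)) :
  large_unit * block Th M = if (n.+1 < r i)%N then block Th M else 0.
Proof.
rewrite /large_unit (block_mul iso); case: ifP => _; first by rewrite mul1r.
by rewrite mul0r (block0 iso).
Qed.

Lemma large_block_order_zero i (e : 'I_2 -> 'M[R[i]]_(r i)) :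
  (n.+1 < r i)%N -> elementary e -> f (e ord0) * f (e ord_max) = 0.
Proof.
move=> ri [einj emin e0].
have [x x0 ex] := minimal_rank1 (emin ord0).
have [y y0 ey] := minimal_rank1 (emin ord_max).
have xy : dotc x y = 0 by apply: dotc_rank1; rewrite // -ex -ey e0.
rewrite ex ey; apply/f_outer_eq0 => //.
apply: (@order_zero_of_frames _ _ _ n) => //.
move=> u u0 uo.
have [|k [l [kl E]]] := @ordphi (fun k => block Th (rank1 (u k))).
  apply: elementary_of_orth => [k|k l kl].
    by apply: (block_minimal iso); exact: rank1_minimal.
  by rewrite -(blockM iso) rank1M_eq0 ?(block0 iso) //; exact: uo.
by exists k, l; split => //; apply/f_outer_eq0.
Qed.

(** On small blocks the cut map is [0] and the conditions hold trivially; on large ones the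
    genericity arguments apply. *)
Lemma ph_ord_le_large : ph_ord_le (fun x => phi (large_unit * x)) n.
Proof.
exists s, r, Th; split => // [i e ee|e [einj emin e0]].
  exists ord0, ord_max; split => //.
  rewrite /= -!/(block Th _) !large_unit_block; case: ifP => ri.
    exact: large_block_order_zero.
  by rewrite linear0 mul0r.
have [t ht] := choice (fun k => minimal_delta (emin k)).
have tI : injective t by move=> k l tkl; apply: einj; rewrite ht tkl -ht.
have E k : phi (large_unit * Th (center_embedding r (e k))) =
    if (n.+1 < r (t k))%N then f (1 : 'M[R[i]]_(r (t k))) else 0.
  rewrite ht center_pred1 large_unit_block; case: ifP => // _.
  by rewrite linear0.
have [[k rk]|large] := pselect (exists k, (r (t k) <= n.+1)%N).
  have [l kl] := ord_other k; exists k, l; split => //=.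
  by rewrite E ltnNge rk mul0r.
have rt k : (n.+1 < r (t k))%N.
  by rewrite ltnNge; apply/negP => h; apply: large; exists k.
have [|k [l [kl fkl]]] := @center_orth_of_vectors _ A s r n t f fD tI.
  move=> w w0.
  have [|k [l [kl kl0]]] := @ordphi (fun k => block Th (rank1 (w (t k)))).
    apply: elementary_of_orth => [k|k l kl].
      by apply: (block_minimal iso); exact: rank1_minimal.
    by apply: (blockM0 iso); rewrite (inj_eq tI).
  by exists k, l; split => //; apply/f_outer_eq0.
by exists k, l; split => //=; rewrite !E !rt.
Qed.

Lemma small_unit_standard_poly d (y : 'I_d -> F) : (n.+1 * n.+1 < d)%N ->
  (1 - large_unit) * standard_poly y = 0.
Proof.
move=> nd; have [[g thK gK] _ mul st] := iso.
have gmul i x z : g (x * z) i = g x i * g z i.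
  by rewrite -{1}(gK x) -{1}(gK z) -mul thK.
have gD i x z : g (x + z) i = g x i + g z i.
  by rewrite -{1}(gK x) -{1}(gK z) -(direct_sumD iso) thK.
have g0 i : g 0 i = 0 by rewrite -(direct_sum0 iso) thK.
have g1 i : g 1 i = 1 by rewrite -(direct_sum1 iso) thK.
have gN i x : g (- x) i = - g x i.
  by apply: (addrI (g x i)); rewrite -gD !subrr g0.
have gS i : g (standard_poly y) i = standard_poly (fun k => g (y k) i).
  rewrite /standard_poly (big_morph (fun x => g x i) (gD i) (g0 i)).
  apply: eq_bigr => t _; rewrite gmul.
  rewrite (big_morph (fun x => g x i) (gmul i) (g1 i)).
  by congr (_ * _); case: odd_perm; rewrite ?expr0 ?expr1 ?gN g1.
rewrite -[LHS]gK -(direct_sum0 iso); congr Th.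
apply: functional_extensionality_dep => i; rewrite gmul gD gN g1 /large_unit thK.
case: ifP => ri; first by rewrite subrr mul0r.
rewrite gS standard_poly_matrix ?mulr0 //; apply: leq_ltn_trans nd.
by apply: leq_mul; rewrite leqNgt ri.
Qed.

Lemma large_unit_projection : projection large_unit.
Proof.
have [_ _ mul st] := iso; split.
  rewrite -st; congr Th; apply: functional_extensionality_dep => i.
  by case: ifP => _; rewrite ?star0 ?star1.
rewrite -mul; congr Th; apply: functional_extensionality_dep => i.
by case: ifP => _; rewrite ?mulr0 ?mulr1.
Qed.

Lemma large_unit_central y : GRing.comm large_unit y.
Proof.
have [[g _ gK] _ mul _] := iso; rewrite /GRing.comm -(gK y) -!mul; congr Th.
apply: functional_extensionality_dep => i.
by case: ifP => _; rewrite ?mul0r ?mulr0 // mul1r mulr1.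
Qed.

End SmallBlocks.

Lemma large_blocks_projection (R : realType) (F A : cstarAlgebra R)
    (phi : {linear F -> A}) n d :
  finite_dimensional F -> ord_le phi n -> (n.+1 * n.+1 < d)%N ->
  exists q : F, [/\ projection q, forall y, GRing.comm q y,
    forall y : 'I_d -> F, (1 - q) * standard_poly y = 0 &
    ph_ord_le (fun x => phi (q * x)) n].
Proof.
move=> /finite_dimensional_orth[m /bounded_orth_direct_sum[s [r [Th [r0 iso]]]]].
move=> ordphi nd; exists (large_unit n Th); split.
- exact: large_unit_projection.
- exact: large_unit_central.
- by move=> y; exact: small_unit_standard_poly.
- exact: ph_ord_le_large.
Qed.

(** * Cutting a map by a central projection *)

Section Cut.
Variables (R : realType) (F A : cstarAlgebra R) (q : F) (phi : {linear F -> A}).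

Definition cut_map (x : F) : A := phi (q * x).

Lemma cut_map_linear : linear cut_map.
Proof.
by move=> c x y; rewrite /cut_map mulrDr -scaleAr linearP.
Qed.

HB.instance Definition _ := GRing.isLinear.Build R[i] F A *:%R cut_map cut_map_linear.

Lemma projection_nrm : projection q -> nrm q <= 1.
Proof.
by move=> [sq qq]; have := nrm_sqr sq; rewrite qq; have := nrm_ge0 q; nra.
Qed.

(** For a central projection, [q * (star y * y) = star (q * y) * (q * y)], so multiplication by [q]
    preserves positive matrices. *)
Lemma cpc_cut_map : projection q -> (forall y, GRing.comm q y) -> cpc phi -> cpc cut_map.
Proof.
move=> pq qc cphi; split.
  move=> n x [y xE]; have [sq qq] := pq.
  have [z zE] := cphi.1 _ _ (ex_intro _ (map_mx (fun a => q * a) y) erefl).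
  exists z; rewrite -zE; apply/matrixP => i j; rewrite !mxE.
  rewrite -[LHS]/(phi (q * x i j)) xE mxE mulr_sumr.
  congr (phi _); apply: eq_bigr => k _; rewrite !mxE starM sq.
  by rewrite -[RHS]mulrA (mulrA q q) qq mulrA qc mulrA.
move=> x; rewrite /= !nrmE lecR; apply: le_trans (cpc_nrm _ cphi) _.
apply: le_trans (nrmM _ _) _; have := projection_nrm pq.
by have := nrm_ge0 x; nra.
Qed.

End Cut.

(** * Asymptotics along approximating nets *)

Section Nets.
Variables (R : realType) (L : Type) (le : L -> L -> Prop).
Hypothesis dir : directed le.

Lemma tails_filter : Filter (tails le).
Proof.
have [[l0] le_refl le_trans le_dir] := dir.
apply: filter_from_filter; first by exists l0.
move=> l m _ _; have [k [lk mk]] := le_dir l m; exists k => // j /= kj.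
by split; [exact: le_trans lk kj | exact: le_trans mk kj].
Qed.

Definition null_net (u : L -> R) :=
  forall e, 0 < e -> exists l, forall m, le l m -> u m <= e.

Lemma null_netD u v : null_net u -> null_net v -> null_net (fun l => u l + v l).
Proof.
have [_ _ le_trans le_dir] := dir.
move=> hu hv e e0; have e2 : 0 < e / 2 by lra.
have [l hl] := hu _ e2; have [m hm] := hv _ e2.
have [k [lk mk]] := le_dir l m; exists k => j kj.
have := hl _ (le_trans _ _ _ lk kj); have := hm _ (le_trans _ _ _ mk kj); lra.
Qed.

Lemma null_net_le (c : R) u v : 0 <= c -> (forall l, 0 <= v l) ->
  (forall l, u l <= c * v l) -> null_net v -> null_net u.
Proof.
move=> c0 v0 uv hv e e0; have f0 : 0 < e / (c + 1) by apply: divr_gt0; lra.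
have [l hl] := hv _ f0; exists l => m lm.
apply: (@Order.POrderTheory.le_trans _ _ _ _ _ (uv m)).
by apply: mul_le_eps => //; exact: hl.
Qed.

Lemma null_net_sqr (c : R) u v : 0 <= c -> (forall l, 0 <= v l) ->
  (forall l, 0 <= u l) -> (forall l, u l ^+ 2 <= c * v l) -> null_net v ->
  null_net u.
Proof.
move=> c0 v0 u0 uv hv e e0.
have e20 : 0 < e ^+ 2 by rewrite exprn_gt0.
have [l hl] := @null_net_le c (fun l => u l ^+ 2) v c0 v0 uv hv _ e20.
exists l => m /hl; rewrite ler_pXn2r ?nnegrE ?u0 //; exact: ltW.
Qed.

Variable A : cstarAlgebra R.
Implicit Types f g h : L -> A.

Lemma cvg_null_net f (a : A) :
  f l @[l --> tails le] --> a <-> null_net (fun l => nrm (f l - a)).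
Proof.
have FF := tails_filter; split.
  move=> fa e e0; have eC : 0 < e%:C :> R[i] by rewrite ltcR.
  have [l _ hl] := (@cvgrPdist_lt _ _ _ _ _ _ _).1 fa _ eC.
  by exists l => m /hl /=; rewrite nrmE ltcR -nrmN opprB => /ltW.
move=> fa; apply/cvgrPdist_lt => E E0.
have E_real : E = (complex.Re E)%:C by rewrite RRe_real // gtr0_real.
have e0 : 0 < complex.Re E / 2 by rewrite divr_gt0 // -ltcR -E_real.
have [l hl] := fa _ e0; exists l => // m /= /hl.
by rewrite E_real nrmE ltcR -nrmN opprB => h; apply: le_lt_trans h _; lra.
Qed.

Definition asymp f g := null_net (fun l => nrm (f l - g l)).

Lemma asymp_refl f : asymp f f.
Proof.
have [[l0] _ _ _] := dir.
by move=> e e0; exists l0 => m _; rewrite subrr nrm0 ltW.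
Qed.

Lemma asymp_le (c : R) f g f' g' : 0 <= c ->
  (forall l, nrm (f l - g l) <= c * nrm (f' l - g' l)) ->
  asymp f' g' -> asymp f g.
Proof. by move=> c0 h; apply: null_net_le c0 _ h => l; exact: nrm_ge0. Qed.

Lemma asymp_sym f g : asymp f g -> asymp g f.
Proof.
by apply: (@asymp_le 1) => // l; rewrite mul1r -nrmN opprB.
Qed.

Lemma asympD f g f' g' : asymp f g -> asymp f' g' ->
  asymp (fun l => f l + f' l) (fun l => g l + g' l).
Proof.
move=> fg fg'; apply: (null_net_le ler01 _ _ (null_netD fg fg')) => l.
  by rewrite addr_ge0 // nrm_ge0.
rewrite mul1r; have -> : f l + f' l - (g l + g' l) = (f l - g l) + (f' l - g' l).
  by ncring.
exact: nrmD.
Qed.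

Lemma asymp_trans g f h : asymp f g -> asymp g h -> asymp f h.
Proof.
move=> fg gh; apply: (null_net_le ler01 _ _ (null_netD fg gh)) => l.
  by rewrite addr_ge0 // nrm_ge0.
rewrite mul1r; have -> : f l - h l = (f l - g l) + (g l - h l) by ncring.
exact: nrmD.
Qed.

Lemma asympN f g : asymp f g -> asymp (fun l => - f l) (fun l => - g l).
Proof.
apply: (@asymp_le 1) => // l; rewrite mul1r.
have -> : - f l - - g l = - (f l - g l) by ncring.
by rewrite nrmN.
Qed.

Lemma asympMr (a : A) f g : asymp f g -> asymp (fun l => f l * a) (fun l => g l * a).
Proof.
apply: (@asymp_le (nrm a)) => [|l]; first exact: nrm_ge0.
by rewrite -mulrBl mulrC; exact: nrmM.
Qed.

Lemma asympMl (a : A) f g : asymp f g -> asymp (fun l => a * f l) (fun l => a * g l).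
Proof.
apply: (@asymp_le (nrm a)) => [|l]; first exact: nrm_ge0.
by rewrite -mulrBr; exact: nrmM.
Qed.

Lemma asymp_star f g : asymp f g -> asymp (fun l => star (f l)) (fun l => star (g l)).
Proof.
by apply: (@asymp_le 1) => // l; rewrite mul1r -starB nrm_star.
Qed.

Lemma asymp_sum I (r : seq I) (f g : I -> L -> A) :
  (forall i, asymp (f i) (g i)) ->
  asymp (fun l => \sum_(i <- r) f i l) (fun l => \sum_(i <- r) g i l).
Proof.
move=> fg; elim: r => [|i r IH].
  have := asymp_refl (fun=> 0); congr asymp; apply: funext => l; by rewrite big_nil.
have := asympD (fg i) IH.
by congr asymp; apply: funext => l; rewrite big_cons.
Qed.

Variables (F : L -> cstarAlgebra R).
Variables (psi : forall l, {linear A -> F l}) (phi : forall l, {linear F l -> A}).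
Hypothesis cpc_psi : forall l, cpc (psi l).
Hypothesis cpc_phi : forall l, cpc (phi l).
Hypothesis approx : forall a, asymp (fun l => phi l (psi l a)) (fun=> a).

Definition bounded_net (x : forall l, F l) := exists b, forall l, nrm (x l) <= b.

(** The square of the multiplicative defect is at most a constant times the Schwarz defect of the
    composite at [a], which tends to [0]. *)
Lemma asymp_mul (x : forall l, F l) a : bounded_net x ->
  asymp (fun l => phi l (x l * psi l a)) (fun l => phi l (x l) * a).
Proof.
have [[l0] _ _ _] := dir.
move=> [b hb]; have b0 : 0 <= b := le_trans (nrm_ge0 _) (hb l0).
have psia l : nrm (phi l (psi l a)) <= nrm a.
  exact: le_trans (cpc_nrm _ (cpc_phi l)) (cpc_nrm _ (cpc_psi l)).
apply: (asymp_trans (g := fun l => phi l (x l) * phi l (psi l a))); last first.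
  apply: (asymp_le b0 _ (approx a)) => l; rewrite -mulrBr.
  apply: le_trans (nrmM _ _) _; apply: ler_wpM2r; first exact: nrm_ge0.
  exact: le_trans (cpc_nrm _ (cpc_phi l)) (hb l).
pose v l :=
  nrm (phi l (psi l (star a * a)) - star (phi l (psi l a)) * phi l (psi l a)).
(* The added [1] makes the constant strictly positive, as [approx_multiplicative] requires. *)
apply: (null_net_sqr (c := b ^+ 2 + 1) (v := v)).
- by rewrite addr_ge0 ?sqr_ge0.
- by move=> l; exact: nrm_ge0.
- by move=> l; exact: nrm_ge0.
- move=> l; apply: approx_multiplicative; [exact: cpc_psi|exact: cpc_phi| |].
    by rewrite ltr_wpDl ?sqr_ge0.
  by have := hb l; have := nrm_ge0 (x l); nra.
apply: (asymp_trans (approx (star a * a))); apply: asymp_sym.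
apply: (asymp_trans (g := fun l => star a * phi l (psi l a))).
  apply: (asymp_le (nrm_ge0 a) _ (asymp_star (approx a))) => l.
  rewrite -mulrBl mulrC; apply: le_trans (nrmM _ _) _.
  by apply: ler_wpM2l; rewrite ?nrm_ge0.
by apply: asympMl; exact: approx.
Qed.

(** The first factor [psi l a] is absorbed into the bounded net, so the induction is over all
    [x]. *)
Lemma asymp_prod (x : forall l, F l) (s : seq A) : bounded_net x ->
  asymp (fun l => phi l (x l * \prod_(a <- s) psi l a))
        (fun l => phi l (x l) * \prod_(a <- s) a).
Proof.
elim: s x => [|a s IH] x bx.
  have := asymp_refl (fun l => phi l (x l)).
  by congr asymp; apply: funext => l; rewrite big_nil mulr1.
have bx' : bounded_net (fun l => x l * psi l a).
  case: bx => b hb; exists (b * nrm a) => l; apply: le_trans (nrmM _ _) _.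
  by apply: ler_pM; rewrite ?nrm_ge0 //; exact: cpc_nrm.
have := asymp_trans (IH _ bx') (asympMr (\prod_(a <- s) a) (asymp_mul a bx)).
by congr asymp; apply: funext => l; rewrite big_cons mulrA.
Qed.

Lemma asymp_standard_poly (x : forall l, F l) d (a : 'I_d -> A) : bounded_net x ->
  asymp (fun l => phi l (x l * standard_poly (fun i => psi l (a i))))
        (fun l => phi l (x l) * standard_poly a).
Proof.
move=> bx.
have S (t : 'S_d) : asymp
    (fun l => phi l (x l * ((-1) ^+ t * \prod_i psi l (a (t i)))))
    (fun l => phi l (x l) * ((-1) ^+ t * \prod_i a (t i))).
  have P : asymp (fun l => phi l (x l * \prod_i psi l (a (t i))))
      (fun l => phi l (x l) * \prod_i a (t i)).
    have := asymp_prod [seq a (t i) | i <- index_enum 'I_d] bx.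
    by rewrite big_map; congr asymp; apply: funext => l; rewrite big_map.
  case: odd_perm; last first.
    by move: P; congr asymp; apply: funext => l; rewrite expr0 mul1r.
  move: (asympN P); congr asymp; apply: funext => l.
    by rewrite expr1 mulN1r mulrN linearN.
  by rewrite expr1 mulN1r mulrN.
have := asymp_sum (index_enum 'S_d) S; congr asymp; apply: funext => l.
  by rewrite /standard_poly mulr_sumr linear_sum.
by rewrite /standard_poly mulr_sumr.
Qed.

End Nets.

(** * Comparison of the two ranks *)

Lemma direct_sum_hr_le (R : realType) (A : cstarAlgebra R) s (r : 'I_s -> nat)
    (Th : (forall i, 'M[R[i]]_(r i)) -> A) n :
  (forall i, (0 < r i)%N) -> direct_sum_iso Th -> hr_le A n.
Proof.
(* A one-point net of identity maps; these keep orthogonal projections orthogonal. *)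
move=> r0 iso; exists unit, (fun _ _ => True), (fun=> A), (fun=> idfun), (fun=> idfun).
have dir : directed (fun _ _ : unit => True) by split => //; exists; exists tt.
have cid : cpc (idfun : {linear A -> A}).
  by split => // m x; rewrite map_mx_id.
split => //.
- by move=> _; exact: direct_sum_finite_dimensional iso.
- move=> a; apply/(cvg_null_net dir) => e e0; exists tt => _ _.
  by rewrite subrr nrm0 ltW.
move=> _; exists s, r, Th; split => //.
  move=> i e [_ _ e0]; exists ord0, ord_max; split => //=.
  by rewrite -!/(block Th _) -(blockM iso) e0 // (block0 iso).
move=> e [_ _ e0]; exists ord0, ord_max; split => //=.
have [_ _ mul _] := iso; rewrite -mul -(direct_sum0 iso); congr Th.
apply: functional_extensionality_dep => i; rewrite /center_embedding.
have /ffunP/(_ i) := e0 ord0 ord_max isT; rewrite !ffunE => h.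
by rewrite -[_ * _]/(_ *m _) -scalar_mxM h raddf0.
Qed.

Lemma cpr_le_hr_le (R : realType) (A : cstarAlgebra R) n :
  simple A -> cpr_le A n -> hr_le A n.
Proof.
move=> sA [L [le [F [psi [phi [dir Ffin cpcs conv ordphi]]]]]].
pose d := (n.+1 * n.+1).+1.
have [Sd|] := pselect (forall a : 'I_d -> A, standard_poly a = 0).
  (* A chain of degree [d] uses [d + 1] orthogonal elements. *)
  have [|s [r [Th [r0 iso]]]] := @bounded_orth_direct_sum R A d.+1.
    by move=> x /(simple_standard_poly sA)[a]; rewrite Sd.
  exact: direct_sum_hr_le iso.
move=> /existsNP[a Sa].
have cpsi l := (cpcs l).1; have cphi l := (cpcs l).2.
have approx b : asymp le (fun l => phi l (psi l b)) (fun=> b).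
  exact/(cvg_null_net dir).
pose ex l := cid (large_blocks_projection (Ffin l) (ordphi l) (ltnSn (n.+1 * n.+1))).
pose q l : F l := projT1 (ex l).
have hq l : [/\ projection (q l), forall y, GRing.comm (q l) y,
    forall y : 'I_d -> F l, (1 - q l) * standard_poly y = 0 &
    ph_ord_le (fun x => phi l (q l * x)) n] := projT2 (ex l).
pose p l := 1 - q l; pose h l := phi l (p l).
have bp : bounded_net p.
  exists 2 => l; have [pq _ _ _] := hq l.
  by have := nrmB 1 (q l); have := nrm1 (F l); have := projection_nrm pq; rewrite /p; lra.
have h0 : asymp le (fun l => h l * standard_poly a) (fun=> 0).
  apply: asymp_sym; have := asymp_standard_poly dir cpsi cphi approx a bp.
  congr asymp; apply: funext => l; have [_ _ -> _] := hq l.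
  by rewrite linear0.
(* Adjoints of the relation for [star b] give the product in the other order; inside [phi l] both
   orders agree because [p l] is central. *)
have hcomm b : asymp le (fun l => h l * b) (fun l => b * h l).
  have pc := asymp_mul dir cpsi cphi approx _ bp.
  apply: (asymp_trans dir (asymp_sym (pc b))).
  have := asymp_star (pc (star b)); congr asymp; apply: funext => l.
    have [[sq _] qc _ _] := hq l.
    rewrite -(cp_star _ (cphi l).1) starM -(cp_star _ (cpsi l).1) starK.
    congr (phi l _); rewrite starB star1 sq /p.
    by rewrite mulrBr mulrBl mul1r mulr1 qc.
  have [[sq _] _ _ _] := hq l.
  by rewrite starM starK -(cp_star _ (cphi l).1) starB star1 sq.
have [b hb] := bp.
have [[l0] _ _ _] := dir.
have b0 : 0 <= b := le_trans (nrm_ge0 _) (hb l0).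
have nh l : nrm (h l) <= b by exact: le_trans (cpc_nrm _ (cphi l)) (hb l).
pose J : set A := [set z | asymp le (fun l => h l * z) (fun=> 0)].
have [_ /(_ J)] := sA; case.
- apply: nrm_closed => z hz e e0; have e2 : 0 < e / 2 by lra.
  have f0 : 0 < e / 2 / (b + 1) by apply: divr_gt0 => //; lra.
  have [y Jy zy] := hz _ f0; have [l hl] := Jy _ e2; exists l => m /hl.
  rewrite !subr0 => hy; have -> : h m * z = h m * (z - y) + h m * y.
    by rewrite -mulrDr subrK.
  apply: le_trans (nrmD _ _) _; rewrite [e]splitr; apply: lerD => //.
  apply: le_trans (nrmM _ _) _.
  apply: le_trans (ler_wpM2r (nrm_ge0 _) (nh m)) _.
  exact: mul_le_eps (nrm_ge0 _) zy.
- have := asymp_refl dir (fun=> 0 : A); congr asymp; apply: funext => l.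
  by rewrite mulr0.
- move=> x y Jx Jy; have := asympD dir Jx Jy; congr asymp; apply: funext => l.
    by rewrite mulrDr.
  by rewrite addr0.
- move=> c x Jx; have := asympMr (c *: (1 : A)) Jx; congr asymp; apply: funext => l.
    by rewrite -scaleAr mulr1 scaleAr.
  by rewrite mul0r.
(* For [c * x], the factor [h l] is moved past [c] by asymptotic centrality. *)
- move=> c x Jx; split.
    have := asymp_trans dir (asympMr x (hcomm c)) _; rewrite /J /=.
    have := asympMl c Jx.
    have -> : (fun _ : L => c * 0) = (fun=> 0) by apply: funext => l; rewrite mulr0.
    move=> cJ /(_ (fun=> 0)) H.
    have : asymp le (fun l => h l * c * x) (fun=> 0).
      by apply: H; move: cJ; congr asymp; apply: funext => l; rewrite mulrA.
    by congr asymp; apply: funext => l; rewrite mulrA.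
  have := asympMr c Jx; congr asymp; apply: funext => l.
    by rewrite mulrA.
  by rewrite mul0r.
- by move=> J0; exfalso; apply: Sa; have : J (standard_poly a) by []; rewrite J0.
move=> JT; have J1 : asymp le (fun l => h l * 1) (fun=> 0).
  have : [set: A] (1 : A) by [].
  by rewrite -JT.
(* The cut changes the approximation of [c] by [phi l (p l * psi l c)], which is asymptotic to
   [h l * c] and hence to [0]. *)
exists L, le, F, psi, (fun l => cut_map (q l) (phi l)); split => //.
- move=> l; split => //; have [pq qc _ _] := hq l; exact: cpc_cut_map.
- move=> c; apply/(cvg_null_net dir).
  have hc : asymp le (fun l => h l * c) (fun=> 0).
    have := asympMr c J1; congr asymp; apply: funext => l.
      by rewrite mulr1.
    by rewrite mul0r.
  have pc := asymp_trans dir (asymp_mul dir cpsi cphi approx c bp) hc.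
  have := asympD dir (approx c) (asympN pc).
  have -> : (fun _ : L => c + - 0) = (fun=> c) by apply: funext => l; rewrite subr0.
  congr asymp; apply: funext => l.
  by rewrite -linearB /= /p /cut_map mulrBl mul1r opprB addrC subrK.
- by move=> l; have [_ _ _] := hq l.
Qed.

Theorem theorem3p2p5 (R : realType) (A : cstarAlgebra R) (hA : simple A) :
  hr A = cpr A.
Proof.
congr (least R _); apply/seteqP; split => n; last exact: cpr_le_hr_le.
move=> [L [le [F [psi [phi [dir Ffin cpcs conv ordphi]]]]]].
exists L, le, F, psi, phi; split => // l.
exact: ph_ord_le_ord_le (cpcs l).2 (ordphi l).
Qed.
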